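(* Assume: (Smoothness) for each $i\in\{1,\dots,n\}$, $f_i$ is differentiable in $u$ and in $v_i$, $\nabla_u f_i(u,v_i)$ is $L_u$-Lipschitz in $u$ and $L_{uv}$-Lipschitz in $v_i$, $\nabla_v f_i(u,v_i)$ is $L_v$-Lipschitz in $v_i$ and $L_{vu}$-Lipschitz in $u$; put $L=\max\{L_u,L_v,L_{uv},L_{vu}\}$. (Stochastic gradients) for each $i$ and all $u,v_i$, $\mathbb{E}[\nabla_u F(u,v_i;\xi_i)]=\nabla_u f_i(u,v_i)$, $\mathbb{E}[\nabla_v F(u,v_i;\xi_i)]=\nabla_v f_i(u,v_i)$, $\mathbb{E}\|\nabla_u F(u,v_i;\xi_i)-\nabla_u f_i(u,v_i)\|^2\le\sigma_u^2$ and $\mathbb{E}\|\nabla_v F(u,v_i;\xi_i)-\nabla_v f_i(u,v_i)\|^2\le\sigma_v^2$. Run FedAvg-P for $T$ rounds with all clients participating in every round ($m=n$), and with $\eta_u\ge\max\big(T,\sqrt{\mathcal B^0T/(nLF_0)},\sqrt n\big)$, $\eta_v\ge1$ and $\gamma\le\frac1{84LK}$, where $\gamma=\gamma_u\eta_u=\gamma_v\eta_v$ and $\mathcal B^0=\sum_{i=1}^n\mathbb E\|\nabla_uf_i(u^0,v_i^0)\|^2$. Then $$\frac1T\sum_{t=0}^{T-1}\big(\mathcal G_u^t+\mathcal G_{\mathbf v}^t\big)\le\frac{4F_0}{TK\gamma}+44L\Big(\frac{\sigma_u^2}{n}+\sigma_v^2\Big)\gamma+\frac{LF_0}{T}.$$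 Furthermore, when $\gamma=\Big(84LK+\sqrt{\frac{11LKT}{F_0}\big(\frac{\sigma_u^2}{n}+\sigma_v^2\big)}\Big)^{-1}$, $$\frac1T\sum_{t=0}^{T-1}\big(\mathcal G_u^t+\mathcal G_{\mathbf v}^t\big)\le8\sqrt{\frac{11LF_0}{KT}\Big(\frac{\sigma_u^2}{n}+\sigma_v^2\Big)}+\frac{337LF_0}{T}.$$
   Context: Problem: $n$ clients, shared variable $u\in\mathbb R^{d_u}$, personal variables $\mathbf v=[v_1;\dots;v_n]$, $v_i\in\mathbb R^{d_v}$; $f_i(u,v_i)=\mathbb E_{\xi_i\sim\mathcal D_i}[F(u,v_i;\xi_i)]$ and $f(u,\mathbf v)=\frac1n\sum_{i=1}^n f_i(u,v_i)$. $\nabla_u,\nabla_v$ are the partial gradients in the first and second argument; $\|\cdot\|$ is Euclidean. FedAvg-P algorithm: parameters $T\ge1$ rounds, $K\ge1$ local steps, $1\le m\le n$, step sizes $\gamma_u,\gamma_v,\eta_u,\eta_v>0$ satisfying $\gamma_u\eta_u=\gamma_v\eta_v=:\gamma$; deterministic initial point $(u^0,\mathbf v^0)$. In each round $t=0,\dots,T-1$: draw $\mathcal S^t\subset\{1,\dots,n\}$ uniformly at random among subsets of size $m$ (so $\mathcal S^t=\{1,\dots,n\}$ if $m=n$). Each $i\in\mathcal S^t$ sets $u_{i,0}^t=u^t$, $v_{i,0}^t=v_i^t$, and for $k=0,\dots,K-1$ performs $u_{i,k+1}^t=u_{i,k}^t-\gamma_u\nabla_uF(u_{i,k}^t,v_{i,k}^t;\xi_{i,k}^t)$,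 $v_{i,k+1}^t=v_{i,k}^t-\gamma_v\nabla_vF(u_{i,k}^t,v_{i,k}^t;\xi_{i,k}^t)$, with $\xi_{i,k}^t\sim\mathcal D_i$; then $v_i^{t+1}=(1-\eta_v)v_i^t+\eta_v v_{i,K}^t$. Finally $u^{t+1}=(1-\eta_u)u^t+\frac{\eta_u}{m}\sum_{i\in\mathcal S^t}u_{i,K}^t$. All samples $\xi_{i,k}^t$ are mutually independent. Notation: $\mathcal G_u^t=\mathbb E\|\nabla_uf(u^t,\mathbf v^t)\|^2$, $\mathcal G_{\mathbf v}^t=\frac1n\sum_{i=1}^n\mathbb E\|\nabla_vf_i(u^t,v_i^t)\|^2$, $F_0=f(u^0,\mathbf v^0)-\inf_{u,\mathbf v}f(u,\mathbf v)$. Assume $L>0$ and $0<F_0<\infty$. *)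

(* Defs.v *)
From HB Require Import structures.
From mathcomp Require Import all_boot all_order all_algebra.
From mathcomp Require Import all_classical all_reals all_analysis.

Set Implicit Arguments.
Unset Strict Implicit.
Unset Printing Implicit Defensive.

Import Order.TTheory GRing.Theory Num.Theory.
Import numFieldNormedType.Exports.

Local Open Scope classical_set_scope.
Local Open Scope ring_scope.

(* The library norm on 'rV[R]_n is the sup norm, hence a separate Euclidean
   norm; both induce the same topology, so [differentiable] is unaffected. *)
Definition l2norm (R : realType) (n : nat) (x : 'rV[R]_n) : R :=
  Num.sqrt (\sum_(j < n) x 0 j ^+ 2).

Definition l2lipschitz (R : realType) (m n : nat) (c : R)
    (g : 'rV[R]_m -> 'rV[R]_n) : Prop :=
  forall x y, l2norm (g x - g y) <= c * l2norm (x - y).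

Definition grad (R : realType) (n : nat) (g : 'rV[R]_n -> R) (x : 'rV[R]_n)
    : 'rV[R]_n :=
  \row_(j < n) 'D_(delta_mx 0 j) g x.

(* [B] is left arbitrary so that [grad_u] applies both to the client
   objectives (B = R^dv) and to the global one (B = 'I_n -> R^dv). *)
Definition grad_u (R : realType) (du : nat) (B : Type)
    (g : 'rV[R]_du -> B -> R) (u : 'rV[R]_du) (v : B) : 'rV[R]_du :=
  grad (fun x => g x v) u.

Definition grad_v (R : realType) (dv : nat) (A : Type)
    (g : A -> 'rV[R]_dv -> R) (u : A) (v : 'rV[R]_dv) : 'rV[R]_dv :=
  grad (g u) v.

(* The loss F(u, v; z) is written [F z u v]. *)
Definition client_obj (R : realType) (dX : measure_display)
    (Xi : measurableType dX) (n du dv : nat) (D : 'I_n -> probability Xi R)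
    (F : Xi -> 'rV[R]_du -> 'rV[R]_dv -> R) (i : 'I_n)
    (u : 'rV[R]_du) (v : 'rV[R]_dv) : R :=
  fine ('E_(D i)[fun z => F z u v])%E.

Definition global_obj (R : realType) (n du dv : nat)
    (f : 'I_n -> 'rV[R]_du -> 'rV[R]_dv -> R)
    (u : 'rV[R]_du) (v : 'I_n -> 'rV[R]_dv) : R :=
  n%:R^-1 * \sum_(i < n) f i u (v i).

(* What is needed for the expectations and gradients of F to be meaningful. *)
Definition regular_loss (R : realType) (dX : measure_display)
    (Xi : measurableType dX) (n du dv : nat) (D : 'I_n -> probability Xi R)
    (F : Xi -> 'rV[R]_du -> 'rV[R]_dv -> R) : Prop :=
  [/\ forall i u v, (D i).-integrable setT (fun z => (F z u v)%:E),
      forall z u v, differentiable (fun x => F z x v) u &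
      forall z u v, differentiable (F z u) v].

Definition smooth (R : realType) (n du dv : nat)
    (f : 'I_n -> 'rV[R]_du -> 'rV[R]_dv -> R) (Lu Lv Luv Lvu : R) : Prop :=
  forall i : 'I_n,
    (forall u v, differentiable (fun x => f i x v) u) /\
    (forall u v, differentiable (f i u) v) /\
    (forall v, l2lipschitz Lu (fun u => grad_u (f i) u v)) /\
    (forall u, l2lipschitz Luv (fun v => grad_u (f i) u v)) /\
    (forall u, l2lipschitz Lv (fun v => grad_v (f i) u v)) /\
    (forall v, l2lipschitz Lvu (fun u => grad_v (f i) u v)).

(* Unbiasedness is an equality of vectors, hence stated coordinatewise. *)
Definition stochastic_gradients (R : realType) (dX : measure_display)
    (Xi : measurableType dX) (n du dv : nat) (D : 'I_n -> probability Xi R)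
    (F : Xi -> 'rV[R]_du -> 'rV[R]_dv -> R)
    (f : 'I_n -> 'rV[R]_du -> 'rV[R]_dv -> R) (sigma_u sigma_v : R) : Prop :=
  forall (i : 'I_n) u v,
    (forall j, 'E_(D i)[fun z => grad_u (F z) u v 0%R j]
               = (grad_u (f i) u v 0%R j)%:E)%E /\
    (forall j, 'E_(D i)[fun z => grad_v (F z) u v 0%R j]
               = (grad_v (f i) u v 0%R j)%:E)%E /\
    ('E_(D i)[fun z => (l2norm (grad_u (F z) u v - grad_u (f i) u v) ^+ 2)%R]
       <= (sigma_u ^+ 2)%:E)%E /\
    ('E_(D i)[fun z => (l2norm (grad_v (F z) u v - grad_v (f i) u v) ^+ 2)%R]
       <= (sigma_v ^+ 2)%:E)%E.

Definition mutually_independent (R : realType) (d dX : measure_display)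
    (Omega : measurableType d) (Xi : measurableType dX)
    (P : probability Omega R) (I : finType) (X : I -> Omega -> Xi) : Prop :=
  forall (J : {set I}) (A : I -> set Xi), (forall j, measurable (A j)) ->
    P [set w | forall j, j \in J -> A j (X j w)]
    = (\prod_(j in J) P (X j @^-1` A j))%E.

(* Samples used by T rounds of K local steps; [xi t i k] is the sample of
   client i at local step k of round t.  Indices t >= T or k >= K are
   irrelevant and unconstrained. *)
Definition independent_samples (R : realType) (d dX : measure_display)
    (Omega : measurableType d) (Xi : measurableType dX)
    (P : probability Omega R) (n T K : nat) (D : 'I_n -> probability Xi R)
    (xi : nat -> 'I_n -> nat -> Omega -> Xi) : Prop :=
  [/\ forall t i k, (t < T)%N -> (k < K)%N -> measurable_fun setT (xi t i k),
      forall t i k, (t < T)%N -> (k < K)%N -> forall A, measurable A ->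
        P (xi t i k @^-1` A) = D i A &
      mutually_independent P
        (fun j : 'I_T * 'I_n * 'I_K => xi j.1.1 j.1.2 j.2)].

(* Both components are updated from the same point and the same sample. *)
Fixpoint local_iter (R : realType) (Xi : Type) (du dv : nat)
    (F : Xi -> 'rV[R]_du -> 'rV[R]_dv -> R) (gamma_u gamma_v : R)
    (z : nat -> Xi) (u : 'rV[R]_du) (v : 'rV[R]_dv) (k : nat)
    : 'rV[R]_du * 'rV[R]_dv :=
  if k is k'.+1 then
    let p := local_iter F gamma_u gamma_v z u v k' in
    (p.1 - gamma_u *: grad_u (F (z k')) p.1 p.2,
     p.2 - gamma_v *: grad_v (F (z k')) p.1 p.2)
  else (u, v).

Definition fedavgp_round (R : realType) (Xi : Type) (n du dv : nat)
    (F : Xi -> 'rV[R]_du -> 'rV[R]_dv -> R)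
    (gamma_u gamma_v eta_u eta_v : R) (K : nat) (S : {set 'I_n})
    (z : 'I_n -> nat -> Xi) (x : 'rV[R]_du * ('I_n -> 'rV[R]_dv))
    : 'rV[R]_du * ('I_n -> 'rV[R]_dv) :=
  let out i := local_iter F gamma_u gamma_v (z i) x.1 (x.2 i) K in
  ((1 - eta_u) *: x.1 + (eta_u / #|S|%:R) *: \sum_(i in S) (out i).1,
   fun i => if i \in S then (1 - eta_v) *: x.2 i + eta_v *: (out i).2
            else x.2 i).

(* The state (u^t, v^t), for given client sets [S t] and samples [z t i k]. *)
Fixpoint fedavgp (R : realType) (Xi : Type) (n du dv : nat)
    (F : Xi -> 'rV[R]_du -> 'rV[R]_dv -> R)
    (gamma_u gamma_v eta_u eta_v : R) (K : nat) (S : nat -> {set 'I_n})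
    (z : nat -> 'I_n -> nat -> Xi)
    (u0 : 'rV[R]_du) (v0 : 'I_n -> 'rV[R]_dv) (t : nat)
    : 'rV[R]_du * ('I_n -> 'rV[R]_dv) :=
  if t is t'.+1 then
    fedavgp_round F gamma_u gamma_v eta_u eta_v K (S t') (z t')
      (fedavgp F gamma_u gamma_v eta_u eta_v K S z u0 v0 t')
  else (u0, v0).

Definition Gu (R : realType) (d : measure_display) (Omega : measurableType d)
    (P : probability Omega R) (n du dv : nat)
    (f : 'I_n -> 'rV[R]_du -> 'rV[R]_dv -> R)
    (X : Omega -> 'rV[R]_du * ('I_n -> 'rV[R]_dv)) : \bar R :=
  ('E_P[fun w => (l2norm (grad_u (global_obj f) (X w).1 (X w).2) ^+ 2)%R])%E.

Definition Gv (R : realType) (d : measure_display) (Omega : measurableType d)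
    (P : probability Omega R) (n du dv : nat)
    (f : 'I_n -> 'rV[R]_du -> 'rV[R]_dv -> R)
    (X : Omega -> 'rV[R]_du * ('I_n -> 'rV[R]_dv)) : \bar R :=
  ((n%:R^-1)%:E * \sum_(i < n)
     'E_P[fun w => (l2norm (grad_v (f i) (X w).1 ((X w).2 i)) ^+ 2)%R])%E.

Definition obj_gap (R : realType) (n du dv : nat)
    (f : 'I_n -> 'rV[R]_du -> 'rV[R]_dv -> R)
    (u0 : 'rV[R]_du) (v0 : 'I_n -> 'rV[R]_dv) : \bar R :=
  ((global_obj f u0 v0)%:E -
   ereal_inf [set (global_obj f p.1 p.2)%:E
              | p in [set: 'rV[R]_du * ('I_n -> 'rV[R]_dv)]])%E.

(* Main.v *)
(* Split every stochastic gradient into the true gradient and a noise vector.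
   For a fixed realization of the noise, smoothness gives a descent inequality
   for each round, up to the drift of the local iterates, which
   gamma L K <= 1/84 allows to absorb.  Without any heterogeneity assumption
   the drift involves B^t = sum_i |grad_u f_i(u^t, v_i^t)|^2; it is compared
   with B^0 through the total displacement of the run, and it carries the
   factor gamma_u^2 = gamma^2 / eta_u^2, which eta_u >= T and
   eta_u^2 >= B^0 T / (n L F_0) make harmless.  Telescoping against inf f then
   bounds the sum of squared gradients by an expression where the noise occurs
   only linearly, paired with gradients at the start of a round, and through
   squared norms of partial sums.

   For the expectation, single out one sample (t, i, k) and equip Omega with
   the sigma-algebra generated by all the others: there the law of
   (omega, sample) is a product measure, so by Fubini the noise is orthogonal
   to everything that depends on the other samples only.  Hence the linear
   terms vanish and the squared norms add up without cross terms. *)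
Require Import Defs.
From HB Require Import structures.
From mathcomp Require Import all_boot all_order all_algebra.
From mathcomp Require Import all_classical all_reals all_analysis.
From mathcomp Require Import measurable_realfun.
From mathcomp Require Import ring lra.

Set Implicit Arguments.
Unset Strict Implicit.
Unset Printing Implicit Defensive.

Import Order.TTheory GRing.Theory Num.Theory.
Import numFieldNormedType.Exports.

Local Open Scope classical_set_scope.
Local Open Scope ring_scope.

(** * Euclidean geometry and descent *)

(** The negative squared norms of the accumulated local gradients, which polarization leaves next to
    the negative squared gradients, are the budget of the pathwise argument: they pay for the
    second-order terms of the descent inequality and for the growth of B^t, so neither calls for a
    bound on the gradients themselves.

    Inside a round the noise is never estimated step by step. It stays inside partial sums, because
    orthogonality gives the squared norm of a sum of k noises a mean of order k, where the triangle
    inequality would give k^2.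

    The third lower bound, eta_u >= sqrt n, serves the noise part of the drift. The partial noise
    sums of a single client are not averaged over clients, so their variance carries sigma_u^2 and
    not sigma_u^2 / n; gamma_u^2 <= gamma^2 / n supplies the missing factor.

    Taking expectations term by term needs every term integrable. This is proved by induction along
    the run: gradients grow at most linearly and the noise has bounded variance, so second moments
    remain finite. *)

Definition sqn {R : realType} {m : nat} (x : 'rV[R]_m) : R :=
  \sum_(j < m) x 0 j ^+ 2.

Definition dot {R : realType} {m : nat} (x y : 'rV[R]_m) : R :=
  \sum_(j < m) x 0 j * y 0 j.

Section euclidean.
Context {R : realType} {m : nat}.
Implicit Types (x y z : 'rV[R]_m) (a : R).

Lemma sqn_ge0 x : 0 <= sqn x.
Proof. by apply: sumr_ge0 => j _; exact: sqr_ge0. Qed.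

Lemma coord_sqr_le x c : x 0 c ^+ 2 <= sqn x.
Proof.
by rewrite /sqn (bigD1 c)//= lerDl sumr_ge0// => j _; exact: sqr_ge0.
Qed.

Lemma l2norm_sqr x : l2norm x ^+ 2 = sqn x.
Proof. by rewrite /l2norm sqr_sqrtr// sqn_ge0. Qed.

Lemma sqnZ a x : sqn (a *: x) = a ^+ 2 * sqn x.
Proof. by rewrite mulr_sumr; apply: eq_bigr => j _; rewrite mxE exprMn. Qed.

Lemma sqnN x : sqn (- x) = sqn x.
Proof. by apply: eq_bigr => j _; rewrite mxE sqrrN. Qed.

Lemma dotDr x y z : dot x (y + z) = dot x y + dot x z.
Proof. by rewrite -big_split; apply: eq_bigr => j _; rewrite mxE mulrDr. Qed.

Lemma dotZr a x y : dot x (a *: y) = a * dot x y.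
Proof. by rewrite mulr_sumr; apply: eq_bigr => j _; rewrite mxE mulrCA. Qed.

Lemma dotC x y : dot x y = dot y x.
Proof. by apply: eq_bigr => j _; rewrite mulrC. Qed.

Lemma dotNr x y : dot x (- y) = - dot x y.
Proof. by rewrite -sumrN; apply: eq_bigr => j _; rewrite mxE mulrN. Qed.

Lemma dotZl a x y : dot (a *: x) y = a * dot x y.
Proof. by rewrite dotC dotZr dotC. Qed.

Lemma dotBl x y z : dot (x - y) z = dot x z - dot y z.
Proof.
by rewrite -sumrN -big_split; apply: eq_bigr => j _; rewrite !mxE mulrDl mulNr.
Qed.

Lemma sqnB x y : sqn (x - y) = sqn x + sqn y - 2 * dot x y.
Proof.
rewrite /sqn /dot mulr_sumr -sumrN -!big_split /=; apply: eq_bigr => j _.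
rewrite !mxE; ring.
Qed.

Lemma dot_le_sqn x y : 2 * dot x y <= sqn x + sqn y.
Proof. by have := sqn_ge0 (x - y); rewrite sqnB; lra. Qed.

Lemma sqnD_le x y : sqn (x + y) <= 2 * (sqn x + sqn y).
Proof.
have := dot_le_sqn x y; have := sqn_ge0 (x - y).
have -> : sqn (x + y) = sqn x + sqn y + 2 * dot x y.
  rewrite /sqn /dot mulr_sumr -!big_split /=; apply: eq_bigr => j _.
  rewrite !mxE; ring.
lra.
Qed.

(** Cauchy-Schwarz against the constant 1: expand the square and use r_i r_j <= (r_i^2 + r_j^2) / 2
    for every pair. *)
Lemma sqr_sum_le (I : finType) (A : {pred I}) (r : I -> R) :
  (\sum_(i in A) r i) ^+ 2 <= #|A|%:R * \sum_(i in A) r i ^+ 2.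
Proof.
have -> : #|A|%:R * \sum_(i in A) r i ^+ 2 =
    2^-1 * \sum_(i in A) \sum_(j in A) (r i ^+ 2 + r j ^+ 2).
  under [X in 2^-1 * X]eq_bigr do rewrite big_split/= sumr_const.
  rewrite big_split /= sumr_const sumrMnl -[X in X + X]mulr_natl; by field.
rewrite expr2 mulr_suml mulr_sumr ler_sum// => i _.
rewrite !mulr_sumr ler_sum// => j _.
have := sqr_ge0 (r i - r j); lra.
Qed.

Lemma sqn_sum_le (I : finType) (A : {pred I}) (x : I -> 'rV[R]_m) :
  sqn (\sum_(i in A) x i) <= #|A|%:R * \sum_(i in A) sqn (x i).
Proof.
rewrite /sqn exchange_big mulr_sumr ler_sum// => j _.
by rewrite summxE sqr_sum_le.
Qed.

End euclidean.

Section descent.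
Context {R : realType}.

Lemma derive_grad_dot {m : nat} (f : 'rV[R]_m -> R) (x a : 'rV[R]_m) :
  differentiable f x -> 'D_a f x = dot (grad f x) a.
Proof.
move=> df; rewrite deriveE// {1}[a]row_sum_delta linear_sum.
apply: eq_bigr => j _.
by rewrite linearZ /= /grad mxE deriveE// mulrC.
Qed.

Lemma descent {m : nat} (f : 'rV[R]_m -> R) (L : R) (x a : 'rV[R]_m) :
  0 < L -> (forall y, differentiable f y) ->
  (forall y z, sqn (grad f y - grad f z) <= L ^+ 2 * sqn (y - z)) ->
  f (x + a) <= f x + dot (grad f x) a + L / 2 * sqn a.
Proof.
move=> L0 df lip.
(* [psi] below subtracts from f on the segment its quadratic upper model. The claim becomes psi 1 <=
   psi 0, which the mean value theorem reduces to the sign of one derivative. *)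
pose phi (s : R) := f (x + s *: a).
pose psi (s : R) := phi s - s * dot (grad f x) a - s ^+ 2 * (L / 2 * sqn a).
have dphi (s : R) : is_derive s 1 phi (dot (grad f (x + s *: a)) a).
  have dfa : derivable f (x + s *: a) a by exact: diff_derivable.
  have E : (fun h : R => h^-1 *: ((phi \o shift s) (h *: (1 : R)) - phi s)) =
      (fun h : R => h^-1 *: ((f \o shift (x + s *: a)) (h *: a) - f (x + s *: a))).
    apply/funext => h; rewrite /= /phi -[h *: 1]/(h * 1) mulr1 [h + s]addrC.
    by rewrite scalerDl addrA [h *: a + _]addrC.
  by apply: DeriveDef; rewrite /derivable/derive E// -/(derive _ _ _) derive_grad_dot.
have dpsi (s : R) : is_derive s 1 psi
    (dot (grad f (x + s *: a)) a - dot (grad f x) a - s * (L * sqn a)).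
  apply: is_derive_eq; rewrite /= !scaler0 ?scale1r /GRing.scale /=.
  by field.
have psi_cont : {within `[0, 1], continuous psi}.
  by apply: derivable_within_continuous => r _; case: (dpsi r).
have [c + psi1] := MVT ltr01 (fun s _ => dpsi s) psi_cont.
rewrite in_itv /= => /andP[c0 _].
suff : psi 1 <= psi 0.
  rewrite /psi /phi scale1r scale0r addr0 !mul0r mul1r expr0n expr1n /= mul0r.
  lra.
(* After multiplication by c L, Young's inequality applies to the gradient difference and c L a,
   both of squared norm at most (c L)^2 |a|^2. This works with the Lipschitz bound in squared
   form. *)
rewrite -subr_le0 psi1 subr0 mulr1 -dotBl -(pmulr_rle0 _ (mulr_gt0 c0 L0)).
have := lip (x + c *: a) x; rewrite addrAC subrr add0r sqnZ => lipc.
have := dot_le_sqn (grad f (x + c *: a) - grad f x) ((c * L) *: a).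
rewrite sqnZ dotZr exprMn => ?.
have : L ^+ 2 * (c ^+ 2 * sqn a) = c ^+ 2 * L ^+ 2 * sqn a by ring.
have : c * L * (c * (L * sqn a)) = c ^+ 2 * L ^+ 2 * sqn a by ring.
lra.
Qed.

(** Move v first, then u. The second move meets the u-gradient at v + b; bringing it back to v costs
    L/2 (|a|^2 + |b|^2) by Young, which on top of the two usual terms L/2 |a|^2 and L/2 |b|^2 gives
    the factor L. *)
Lemma descent2 {m p : nat} (f : 'rV[R]_m -> 'rV[R]_p -> R) (L : R)
    (u a : 'rV[R]_m) (v b : 'rV[R]_p) :
  0 < L ->
  (forall u v, differentiable (fun x => f x v) u) ->
  (forall u v, differentiable (f u) v) ->
  (forall u u' v, sqn (grad_u f u v - grad_u f u' v) <= L ^+ 2 * sqn (u - u')) ->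
  (forall u v v', sqn (grad_u f u v - grad_u f u v') <= L ^+ 2 * sqn (v - v')) ->
  (forall u v v', sqn (grad_v f u v - grad_v f u v') <= L ^+ 2 * sqn (v - v')) ->
  f (u + a) (v + b) <= f u v + dot (grad_u f u v) a + dot (grad_v f u v) b
                       + L * (sqn a + sqn b).
Proof.
move=> L0 dfu dfv luu luv lvv.
have := @descent p (f u) L v b L0 (dfv u) (lvv u).
have := @descent m (fun x => f x (v + b)) L u a L0 (dfu^~ (v + b))
  (fun y z => luu y z (v + b)).
rewrite -[grad (f^~ (v + b)) u]/(grad_u f u (v + b)).
rewrite -[grad (f u) v]/(grad_v f u v).
have := luv u (v + b) v; rewrite addrAC subrr add0r => lb.
have := dot_le_sqn (L^-1 *: (grad_u f u (v + b) - grad_u f u v)) a.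
rewrite dotZl sqnZ dotBl => h.
have {h} : 2 * (dot (grad_u f u (v + b)) a - dot (grad_u f u v) a)
    <= L * (sqn b + sqn a).
  rewrite -(ler_pM2l (_ : 0 < L^-1)) ?invr_gt0// mulrCA (le_trans h)//.
  rewrite mulrA mulVf ?gt_eqF// mul1r lerD2r exprVn ler_pdivrMl ?exprn_gt0//.
lra.
Qed.

End descent.

(** * Displacement and drift of perturbed gradient steps *)

Section drift.
Context {R : realType}.

Lemma sgd_displacement {m : nat} (x h e : nat -> 'rV[R]_m) (c : R) (k : nat) :
  (forall l, x l.+1 = x l - c *: (h l + e l)) ->
  x k = x 0 - c *: (\sum_(l < k) h l + \sum_(l < k) e l).
Proof.
move=> xS; elim: k => [|k IH]; first by rewrite !big_ord0 addr0 scaler0 subr0.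
by rewrite xS IH -!scalerN -addrA -scalerDr -opprD !big_ord_recr/= addrACA.
Qed.

Lemma sqn_prefix_sum_le {m : nat} (e : nat -> 'rV[R]_m) (k K : nat) :
  (k <= K)%N -> sqn (\sum_(l < k) e l) <= K%:R * \sum_(l < K) sqn (e l).
Proof.
move=> kK; apply: le_trans (sqn_sum_le predT _) _; rewrite card_ord.
apply: ler_pM; rewrite ?ler_nat//.
  by apply: sumr_ge0 => l _; exact: sqn_ge0.
rewrite (big_ord_widen K (fun l => sqn (e l)) kK) big_mkcond /=.
by apply: ler_sum => l _; case: ifP => // _; exact: sqn_ge0.
Qed.

(** The two parts are treated differently: Cauchy-Schwarz splits the gradients, while the noise
    stays in one partial sum so that orthogonality can act on it later. *)
Lemma sgd_displacement_le {m : nat} (x h e : nat -> 'rV[R]_m) (c : R) (k K : nat) :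
  (forall l, x l.+1 = x l - c *: (h l + e l)) -> (k <= K)%N ->
  sqn (x k - x 0) <=
  2 * c ^+ 2 * (K%:R * \sum_(l < K) sqn (h l) + sqn (\sum_(l < k) e l)).
Proof.
move=> xS kK; rewrite (sgd_displacement k xS) addrAC subrr add0r sqnN sqnZ.
rewrite -[leRHS]mulrA [leRHS]mulrCA ler_wpM2l ?sqr_ge0// (le_trans (sqnD_le _ _))//.
by rewrite ler_wpM2l// lerD2r sqn_prefix_sum_le.
Qed.

(** A self-bounding estimate. Each gradient is within Lipschitz distance of the initial one, so the
    drift reappears on the right with factor 8 (a^2 + b^2) L^2 K^2 <= 16 c^2 L^2 K^2 <= 1/2; this is
    what 1/32 is for, and absorbing it doubles the other terms. The steps a and b stay separate
    because a will be gamma_u, whose smallness must survive in front of the u-gradient. *)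
Lemma local_drift {m p : nat} (x : nat -> 'rV[R]_m) (y : nat -> 'rV[R]_p)
    (gx ex : nat -> 'rV[R]_m) (gy ey : nat -> 'rV[R]_p) (L a b c : R) (K : nat) :
  (forall l, x l.+1 = x l - a *: (gx l + ex l)) ->
  (forall l, y l.+1 = y l - b *: (gy l + ey l)) ->
  (forall l, sqn (gx l - gx 0) <=
     2 * L ^+ 2 * (sqn (x l - x 0) + sqn (y l - y 0))) ->
  (forall l, sqn (gy l - gy 0) <=
     2 * L ^+ 2 * (sqn (x l - x 0) + sqn (y l - y 0))) ->
  0 <= a <= c -> 0 <= b <= c -> c ^+ 2 * L ^+ 2 * K%:R ^+ 2 <= 1 / 32 ->
  \sum_(k < K) (sqn (x k - x 0) + sqn (y k - y 0)) <=
    8 * K%:R ^+ 3 * (a ^+ 2 * sqn (gx 0) + b ^+ 2 * sqn (gy 0)) +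
    4 * \sum_(k < K) (a ^+ 2 * sqn (\sum_(l < k) ex l)
                      + b ^+ 2 * sqn (\sum_(l < k) ey l)).
Proof.
move=> xS yS lx ly /andP[a0 ac] /andP[b0 bc] small.
set DD := \sum_(k < K) (_ + _).
set RR := \sum_(k < K) (a ^+ 2 * _ + _).
have bnd q (g : nat -> 'rV[R]_q) :
    (forall l, sqn (g l - g 0) <=
       2 * L ^+ 2 * (sqn (x l - x 0) + sqn (y l - y 0))) ->
    \sum_(l < K) sqn (g l) <= 2 * K%:R * sqn (g 0) + 4 * L ^+ 2 * DD.
  move=> lg; rewrite (_ : 2 * K%:R * _ = \sum_(l < K) (2 * sqn (g 0))); last first.
    by rewrite sumr_const card_ord -mulr_natl; ring.
  rewrite /DD [4 * _ * _]mulr_sumr -big_split /=; apply: ler_sum => l _.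
  have := sqnD_le (g l - g 0) (g 0); rewrite subrK; have := lg l; lra.
have Kn0 : 0 <= K%:R :> R by [].
have step : DD <= \sum_(k < K)
    (2 * a ^+ 2 * (K%:R * (2 * K%:R * sqn (gx 0) + 4 * L ^+ 2 * DD)) +
     2 * b ^+ 2 * (K%:R * (2 * K%:R * sqn (gy 0) + 4 * L ^+ 2 * DD)) +
     2 * (a ^+ 2 * sqn (\sum_(l < k) ex l) + b ^+ 2 * sqn (\sum_(l < k) ey l))).
  rewrite {1}/DD; apply: ler_sum => k _.
  have kK : (k <= K)%N by exact: ltnW.
  have h1 := sgd_displacement_le xS kK; have h2 := sgd_displacement_le yS kK.
  have a2 : 0 <= 2 * a ^+ 2 by rewrite mulr_ge0// sqr_ge0.
  have b2 : 0 <= 2 * b ^+ 2 by rewrite mulr_ge0// sqr_ge0.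
  have h3 := ler_wpM2l a2 (ler_wpM2l Kn0 (bnd _ _ lx)).
  have h4 := ler_wpM2l b2 (ler_wpM2l Kn0 (bnd _ _ ly)).
  lra.
move: step; rewrite big_split /= sumr_const card_ord -mulr_sumr -/RR.
rewrite -[(_ + _) *+ _]mulr_natl.
have DD0 : 0 <= DD by apply: sumr_ge0 => k _; rewrite addr_ge0 ?sqn_ge0.
have ab : a ^+ 2 + b ^+ 2 <= 2 * c ^+ 2.
  have := ler_pM a0 a0 ac ac; have := ler_pM b0 b0 bc bc; rewrite -!expr2; lra.
have LK0 : 0 <= 8 * (L ^+ 2 * K%:R ^+ 2 * DD).
  by do 2! apply: mulr_ge0 => //; apply: mulr_ge0; exact: sqr_ge0.
have h1 := ler_wpM2r LK0 ab.
have h2 := ler_wpM2r DD0 small.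
have -> : K%:R * (2 * a ^+ 2 * (K%:R * (2 * K%:R * sqn (gx 0) + 4 * L ^+ 2 * DD)) +
   2 * b ^+ 2 * (K%:R * (2 * K%:R * sqn (gy 0) + 4 * L ^+ 2 * DD))) =
   4 * K%:R ^+ 3 * (a ^+ 2 * sqn (gx 0) + b ^+ 2 * sqn (gy 0)) +
   (a ^+ 2 + b ^+ 2) * (8 * (L ^+ 2 * K%:R ^+ 2 * DD)) by ring.
have e1 : 2 * c ^+ 2 * (8 * (L ^+ 2 * K%:R ^+ 2 * DD)) =
  16 * (c ^+ 2 * L ^+ 2 * K%:R ^+ 2 * DD) by ring.
lra.
Qed.

End drift.

(** * Pathwise analysis of a run *)

Section round.
Context {R : realType} {n du dv : nat}.
Variables (f : 'I_n -> 'rV[R]_du -> 'rV[R]_dv -> R).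
Variables (gu : 'I_n -> 'rV[R]_du -> 'rV[R]_dv -> 'rV[R]_du).
Variables (gv : 'I_n -> 'rV[R]_du -> 'rV[R]_dv -> 'rV[R]_dv).
Variables (L : R) (K : nat).
Hypotheses (n0 : (0 < n)%N) (K0 : (0 < K)%N) (L0 : 0 < L).
Hypothesis f_descent : forall i u a v b,
  f i (u + a) (v + b) <= f i u v + dot (gu i u v) a + dot (gv i u v) b
                         + L * (sqn a + sqn b).
Hypothesis gu_lip : forall i u u' v v',
  sqn (gu i u v - gu i u' v') <= 2 * L ^+ 2 * (sqn (u - u') + sqn (v - v')).
Hypothesis gv_lip : forall i u u' v v',
  sqn (gv i u v - gv i u' v') <= 2 * L ^+ 2 * (sqn (u - u') + sqn (v - v')).

(** Polarization. With c = K and p a sum of K local gradients, the first-order term yields descent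
    in both |G|^2 and |p|^2, and the error K G - p is controlled by the drift. *)
Lemma align {m : nat} (G p : 'rV[R]_m) (c : R) : 0 < c ->
  - dot G p = - (c / 2) * sqn G - (2 * c)^-1 * sqn p
              + (2 * c)^-1 * sqn (c *: G - p).
Proof.
move=> c0; rewrite sqnB sqnZ dotZl; by field; exact: lt0r_neq0.
Qed.

Definition client_mean {m : nat} (e : 'I_n -> 'rV[R]_m) : 'rV[R]_m :=
  n%:R^-1 *: \sum_(i < n) e i.

Lemma client_mean_sqn {m : nat} (e : 'I_n -> 'rV[R]_m) :
  sqn (client_mean e) <= n%:R^-1 * \sum_(i < n) sqn (e i).
Proof.
rewrite sqnZ expr2 -mulrA ler_wpM2l ?invr_ge0//.
rewrite ler_pdivrMl ?ltr0n// (le_trans (sqn_sum_le predT e))//.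
by rewrite card_ord.
Qed.

Lemma deviation_le {m : nat} (g0 : 'rV[R]_m) (g : nat -> 'rV[R]_m) (d : nat -> R) :
  (forall k, sqn (g k - g0) <= 2 * L ^+ 2 * d k) ->
  sqn (K%:R *: g0 - \sum_(k < K) g k) <= K%:R * (2 * L ^+ 2 * \sum_(k < K) d k).
Proof.
move=> h.
have -> : K%:R *: g0 - \sum_(k < K) g k = \sum_(k < K) (g0 - g k).
  by rewrite big_split /= sumr_const card_ord scaler_nat -sumrN.
apply: le_trans (sqn_sum_le predT _) _; rewrite card_ord ler_wpM2l//.
rewrite mulr_sumr ler_sum// => k _.
by rewrite -sqnN opprB.
Qed.

(** All clients share the shift of u, so averaging their descent inequalities turns the client
    u-gradients into G, and only the mean noise enters the u-part. Splitting |p + N|^2 <= 2 (|p|^2 +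
    |N|^2) gives 2 L gamma^2; the alignment errors of u and of v each cost gamma L^2 times the mean
    drift. The trajectories x and y are arbitrary here, as the drift is estimated separately. *)
Lemma round_descent (gamma : R) (u : 'rV[R]_du) (v : 'I_n -> 'rV[R]_dv)
    (x eu : 'I_n -> nat -> 'rV[R]_du) (y ev : 'I_n -> nat -> 'rV[R]_dv)
    (drift := fun i => \sum_(k < K) (sqn (x i k - u) + sqn (y i k - v i)))
    (Nu := client_mean (fun i => \sum_(k < K) eu i k))
    (Nv := fun i => \sum_(k < K) ev i k)
    (pu := client_mean (fun i => \sum_(k < K) gu i (x i k) (y i k)))
    (pv := fun i => \sum_(k < K) gv i (x i k) (y i k))
    (G := client_mean (fun i => gu i u (v i)))
    (g := fun i => gv i u (v i)) :
  0 < gamma ->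
  n%:R^-1 * \sum_(i < n) f i (u - gamma *: (pu + Nu))
                             (v i - gamma *: (pv i + Nv i)) <=
  n%:R^-1 * \sum_(i < n) f i u (v i)
  - gamma * K%:R / 2 * (sqn G + n%:R^-1 * \sum_(i < n) sqn (g i))
  - gamma * (dot G Nu + n%:R^-1 * \sum_(i < n) dot (g i) (Nv i))
  - gamma / (2 * K%:R) * (sqn pu + n%:R^-1 * \sum_(i < n) sqn (pv i))
  + 2 * L * gamma ^+ 2 * (sqn pu + n%:R^-1 * \sum_(i < n) sqn (pv i)
                          + (sqn Nu + n%:R^-1 * \sum_(i < n) sqn (Nv i)))
  + 2 * gamma * L ^+ 2 * (n%:R^-1 * \sum_(i < n) drift i).
Proof.
move=> gam0.
have nr0 : 0 < n%:R :> R by rewrite ltr0n.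
have Kr0 : 0 < K%:R :> R by rewrite ltr0n.
have dotG a : dot G a = n%:R^-1 * \sum_(i < n) dot (gu i u (v i)) a.
  rewrite dotZl; congr (_ * _); rewrite /dot.
  rewrite exchange_big; apply: eq_bigr => j _.
  by rewrite summxE mulr_suml.
have stepv i : - dot (g i) (pv i) <= - (K%:R / 2) * sqn (g i)
    - (2 * K%:R)^-1 * sqn (pv i) + L ^+ 2 * drift i.
  rewrite (@align _ _ _ _ Kr0) lerD2l ler_pdivrMl ?mulr_gt0//.
  apply: (le_trans (@deviation_le _ _ _ _ (fun k => gv_lip i (x i k) u (y i k) (v i)))).
  by rewrite -/(drift i) le_eqVlt; apply/orP; left; apply/eqP; ring.
have stepu : - dot G pu <= - (K%:R / 2) * sqn G
    - (2 * K%:R)^-1 * sqn pu + L ^+ 2 * (n%:R^-1 * \sum_(i < n) drift i).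
  rewrite (@align _ _ _ _ Kr0) lerD2l ler_pdivrMl ?mulr_gt0//.
  have -> : K%:R *: G - pu =
      client_mean (fun i => K%:R *: gu i u (v i) - \sum_(k < K) gu i (x i k) (y i k)).
    by rewrite /pu /G /client_mean scalerA mulrC -scalerA -scalerBr big_split /=
      -scaler_sumr sumrN.
  apply: le_trans (client_mean_sqn _) _.
  rewrite [L ^+ 2 * _]mulrCA [leRHS]mulrCA ler_wpM2l ?invr_ge0//.
  rewrite mulrA [leRHS]mulr_sumr ler_sum// => i _.
  apply: (le_trans (@deviation_le _ _ _ _ (fun k => gu_lip i (x i k) u (y i k) (v i)))).
  by rewrite -/(drift i) le_eqVlt; apply/orP; left; apply/eqP; ring.
have svsum : n%:R^-1 * \sum_(i < n) - dot (g i) (pv i) <=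
   n%:R^-1 * \sum_(i < n) (- (K%:R / 2) * sqn (g i)
    - (2 * K%:R)^-1 * sqn (pv i) + L ^+ 2 * drift i).
  by rewrite ler_wpM2l ?invr_ge0// ler_sum.
move: svsum; rewrite big_split /= big_split /= !sumrN -!mulr_sumr => svsum.
have main : n%:R^-1 * \sum_(i < n) f i (u - gamma *: (pu + Nu))
                             (v i - gamma *: (pv i + Nv i)) <=
  n%:R^-1 * \sum_(i < n) (f i u (v i) - gamma * dot (gu i u (v i)) (pu + Nu)
    - gamma * (dot (g i) (pv i) + dot (g i) (Nv i))
    + L * gamma ^+ 2 * (2 * (sqn pu + sqn Nu))
    + L * gamma ^+ 2 * (2 * (sqn (pv i) + sqn (Nv i)))).
  rewrite ler_wpM2l ?invr_ge0// ler_sum// => i _.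
  apply: le_trans (f_descent _ _ _ _ _) _.
  rewrite !dotNr !dotZr !sqnN (sqnZ _ (pu + Nu)) (sqnZ _ (pv i + Nv i)).
  rewrite -/(g i) (dotDr (g i)).
  have c0 : 0 <= L * gamma ^+ 2 by rewrite mulr_ge0 ?ltW// exprn_gt0.
  have := ler_wpM2l c0 (sqnD_le pu Nu).
  have := ler_wpM2l c0 (sqnD_le (pv i) (Nv i)).
  lra.
apply: le_trans main _.
have cst_sum (c : R) : \sum_(i < n) c = n%:R * c.
  by rewrite sumr_const card_ord mulr_natl.
have e1 : n%:R^-1 * \sum_(i < n) dot (gu i u (v i)) (pu + Nu) =
  dot G pu + dot G Nu by rewrite -dotG dotDr.
have h1 := ler_wpM2l (ltW gam0) stepu; have h2 := ler_wpM2l (ltW gam0) svsum.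
rewrite !big_split /= !sumrN -!mulr_sumr !big_split /= !cst_sum.
have e2 (A B C D P Q r c : R) : n%:R^-1 * (A - gamma * B - gamma * (C + D)
      + c * (2 * (n%:R * r + n%:R * P)) + c * (2 * Q)) =
    n%:R^-1 * A - gamma * (n%:R^-1 * B) - gamma * (n%:R^-1 * C)
      - gamma * (n%:R^-1 * D) + 2 * c * (r + P) + 2 * c * (n%:R^-1 * Q).
  by field; rewrite gt_eqF.
rewrite e2 e1; lra.
Qed.


(* Sums over the rounds: SQ of the squared gradients, Sl of the gradient-noise
   pairings, SH and Sq of the squared gradient and noise sums of a round, SR of
   the noise part of the drift, SB of B^t / n; B0 is B^0 / n. *)
Lemma constants_bound (k gamma gamma_u eta_u T F0 B0 SQ Sl SH Sq SR SB : R) :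
  0 < k -> 0 < gamma -> 0 < eta_u -> gamma_u * eta_u = gamma ->
  gamma * L * k <= 1 / 84 -> 0 < F0 -> 0 < T -> T <= eta_u ->
  B0 * T <= L * F0 * eta_u ^+ 2 ->
  0 <= SQ -> 0 <= SH -> 0 <= Sq ->
  SB <= 2 * (B0 * T) + 8 * L ^+ 2 * gamma ^+ 2 * T ^+ 2 * (SH + Sq) ->
  0 <= F0 - gamma * k / 2 * SQ - gamma * Sl - gamma / (2 * k) * SH
     + 2 * L * gamma ^+ 2 * (SH + Sq)
     + 2 * gamma * L ^+ 2 * (8 * k ^+ 3 * (gamma_u ^+ 2 * SB + gamma ^+ 2 * SQ)
                             + 4 * SR) ->
  SQ <= 4 * F0 / (gamma * k) + L * F0 - 4 / k * Sl + 12 * L * gamma / k * Sq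
        + 32 * L ^+ 2 / k * SR.
Proof.
move=> k0 g0 e0 ge small F00 T0 Te hB SQ0 SH0 Sq0 hSB main.
pose s := gamma * L * k.
have s0 : 0 < s by rewrite !mulr_gt0.
rewrite -/s in small.
have ss : s * s <= 1 / 84 * (1 / 84) by apply: ler_pM => //; exact: ltW.
have s4 : s ^+ 4 <= s / 1000.
  have := ler_wpM2r (ltW (mulr_gt0 s0 s0)) ss; have := ler_wpM2l (ltW s0) small.
  lra.
have gu2 : gamma_u ^+ 2 * eta_u ^+ 2 = gamma ^+ 2 by rewrite -exprMn ge.
(* This is where eta_u >= T acts: one factor T comes from the displacement over the run, the other
   from summing over the rounds. *)
have T2 : gamma_u ^+ 2 * T ^+ 2 <= gamma ^+ 2.
  rewrite -gu2 ler_wpM2l ?sqr_ge0//.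
  have := ler_pM (ltW T0) (ltW T0) Te Te; lra.
(* The B0 part uses gamma_u eta_u = gamma: the bound on B0 T carries eta_u^2, which turns gamma_u^2
   into gamma^2. This is the origin of the final L F0. *)
have hSB' : gamma_u ^+ 2 * SB <= gamma ^+ 2 * (2 * L * F0)
              + 8 * L ^+ 2 * gamma ^+ 4 * (SH + Sq).
  apply: le_trans (ler_wpM2l (sqr_ge0 _) hSB) _; rewrite mulrDr lerD//.
    rewrite -gu2 -[leRHS]mulrA ler_wpM2l ?sqr_ge0//; lra.
  have c0 : 0 <= 8 * L ^+ 2 * gamma ^+ 2 * (SH + Sq).
    by rewrite !mulr_ge0 ?addr_ge0 ?(ltW L0) ?(ltW g0).
  have := ler_wpM2l c0 T2; lra.
have k30 : 0 <= 16 * gamma * L ^+ 2 * k ^+ 3.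
  by rewrite !mulr_ge0 ?exprn_ge0 ?ltW.
have h1 := ler_wpM2l k30 hSB'.
have e1 : 16 * gamma * L ^+ 2 * k ^+ 3 *
  (gamma ^+ 2 * (2 * L * F0) + 8 * L ^+ 2 * gamma ^+ 4 * (SH + Sq)) =
  32 * (s * s) * (gamma * k * (L * F0)) + 128 * s ^+ 4 * (gamma / k * (SH + Sq)).
  by rewrite /s; field; rewrite gt_eqF.
have e2 : 16 * gamma * L ^+ 2 * k ^+ 3 * (gamma ^+ 2 * SQ) =
  16 * (s * s) * (gamma * k * SQ) by rewrite /s; ring.
have e3 : 2 * L * gamma ^+ 2 * (SH + Sq) = 2 * s * (gamma / k * (SH + Sq)).
  by rewrite /s; field; rewrite gt_eqF.
have e4 : gamma / (2 * k) * SH = 2^-1 * (gamma / k * SH).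
  by field; rewrite gt_eqF.
rewrite e1 in h1.
have gkF : 0 <= gamma * k * (L * F0) by rewrite !mulr_ge0// ltW.
have gkQ : 0 <= gamma * k * SQ by rewrite !mulr_ge0// ltW.
have gkH : 0 <= gamma / k * SH by rewrite mulr_ge0// ltW// divr_gt0.
have gkq : 0 <= gamma / k * Sq by rewrite mulr_ge0// ltW// divr_gt0.
have m1 := ler_wpM2r gkF ss; have m2 := ler_wpM2r gkQ ss.
have m3 := ler_wpM2r gkH s4; have m4 := ler_wpM2r gkq s4.
have m5 := ler_wpM2r gkH small; have m6 := mulr_ge0 (ltW s0) gkq.
(* The budget: 16 s^2 <= 1/4 leaves half of the descent in SQ; 2 s + 128 s^4 <= 1/2 cancels SH; for
   Sq the same factor is rounded up to 3 s; and 32 s^2 <= 1/4 bounds the coefficient of L F0.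
   Dividing by gamma k / 4 produces the constants 4, 12 and 32. *)
have key : gamma * k / 4 * SQ <= F0 + gamma * k / 4 * (L * F0) - gamma * Sl
    + 3 * s * (gamma / k * Sq) + 8 * gamma * L ^+ 2 * SR.
  lra.
rewrite -(ler_pM2l (_ : 0 < gamma * k / 4)) ?divr_gt0 ?mulr_gt0//.
apply: le_trans key _; rewrite le_eqVlt; apply/orP; left; apply/eqP.
by rewrite /s; field; rewrite !gt_eqF.
Qed.

(** No probability enters: the noises [eu] and [ev] are arbitrary perturbations of recurrences that
    hold exactly, so the inequality can be instantiated at each outcome separately. *)
Lemma fedavgp_pathwise (T : nat) (gamma_u gamma_v eta_u eta_v gamma F0 : R)
    (x : nat -> 'rV[R]_du) (y : nat -> 'I_n -> 'rV[R]_dv)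
    (lx eu : nat -> 'I_n -> nat -> 'rV[R]_du)
    (ly ev : nat -> 'I_n -> nat -> 'rV[R]_dv)
    (Nu := fun t => client_mean (fun i => \sum_(k < K) eu t i k))
    (Nv := fun t i => \sum_(k < K) ev t i k)
    (G := fun t => client_mean (fun i => gu i (x t) (y t i)))
    (g := fun t i => gv i (x t) (y t i)) :
  (0 < T)%N -> 0 < gamma_u -> 0 < gamma_v -> 0 < eta_u -> 0 < eta_v ->
  gamma_u * eta_u = gamma -> gamma_v * eta_v = gamma ->
  gamma * L * K%:R <= 1 / 84 -> 0 < F0 -> T%:R <= eta_u -> 1 <= eta_v ->
  n%:R^-1 * (\sum_(i < n) sqn (gu i (x 0) (y 0 i))) * T%:R
    <= L * F0 * eta_u ^+ 2 ->
  (forall u v, n%:R^-1 * (\sum_(i < n) f i (x 0) (y 0 i)) - F0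
               <= n%:R^-1 * \sum_(i < n) f i u (v i)) ->
  (forall t i, lx t i 0 = x t) -> (forall t i, ly t i 0 = y t i) ->
  (forall t i k, lx t i k.+1 =
     lx t i k - gamma_u *: (gu i (lx t i k) (ly t i k) + eu t i k)) ->
  (forall t i k, ly t i k.+1 =
     ly t i k - gamma_v *: (gv i (lx t i k) (ly t i k) + ev t i k)) ->
  (forall t, x t.+1 =
     (1 - eta_u) *: x t + (eta_u / n%:R) *: \sum_(i < n) lx t i K) ->
  (forall t i, y t.+1 i = (1 - eta_v) *: y t i + eta_v *: ly t i K) ->
  \sum_(t < T) (sqn (G t) + n%:R^-1 * \sum_(i < n) sqn (g t i)) <=
    4 * F0 / (gamma * K%:R) + L * F0
    - 4 / K%:R *
      (\sum_(t < T) (dot (G t) (Nu t) + n%:R^-1 * \sum_(i < n) dot (g t i) (Nv t i)))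
    + 12 * L * gamma / K%:R *
      (\sum_(t < T) (sqn (Nu t) + n%:R^-1 * \sum_(i < n) sqn (Nv t i)))
    + 32 * L ^+ 2 / K%:R *
      (\sum_(t < T) n%:R^-1 * \sum_(i < n) \sum_(k < K)
         (gamma_u ^+ 2 * sqn (\sum_(l < k) eu t i l)
          + gamma_v ^+ 2 * sqn (\sum_(l < k) ev t i l))).
Proof.
move=> T0 gu0 gv0 eu0 ev0 geu gev small F00 Te e1 hB inf lx0 ly0 lxS lyS xS yS.
have nr0 : 0 < n%:R :> R by rewrite ltr0n.
have Kr0 : 0 < K%:R :> R by rewrite ltr0n.
have g0 : 0 < gamma by rewrite -geu mulr_gt0.
have T1 : 1 <= T%:R :> R by rewrite ler1n.
have gug : gamma_u <= gamma.
  by rewrite -geu ler_peMr// ?(ltW gu0)// (le_trans T1).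
have gvg : gamma_v <= gamma by rewrite -gev ler_peMr// (ltW gv0).
pose pu t := client_mean (fun i => \sum_(k < K) gu i (lx t i k) (ly t i k)).
pose pv t i := \sum_(k < K) gv i (lx t i k) (ly t i k).
(* The weights 1 - eta_u and eta_u recombine, so a whole round is a single step of length gamma_u
   eta_u = gamma along the averaged sums of local gradients and noises. *)
have xstep t : x t.+1 = x t - gamma *: (pu t + Nu t).
  rewrite xS; under eq_bigr do
    rewrite (sgd_displacement K (lxS t _)) lx0.
  rewrite big_split /= sumr_const card_ord scalerDr -[x t *+ n]scaler_nat scalerA.
  rewrite divfK ?gt_eqF// addrA -scalerDl subrK scale1r.
  rewrite sumrN -scaler_sumr scalerN scalerA; congr (_ - _).
  rewrite /pu /Nu /client_mean -scalerDr -big_split /= scalerA.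
  by congr (_ *: _); rewrite -geu; ring.
have ystep t i : y t.+1 i = y t i - gamma *: (pv t i + Nv t i).
  rewrite yS (sgd_displacement K (lyS t i)) ly0 scalerBr addrA -scalerDl subrK.
  by rewrite scale1r scalerA [eta_v * _]mulrC gev.
pose Q t := sqn (G t) + n%:R^-1 * \sum_(i < n) sqn (g t i).
pose ell t := dot (G t) (Nu t) + n%:R^-1 * \sum_(i < n) dot (g t i) (Nv t i).
pose H t := sqn (pu t) + n%:R^-1 * \sum_(i < n) sqn (pv t i).
pose q t := sqn (Nu t) + n%:R^-1 * \sum_(i < n) sqn (Nv t i).
pose r t := n%:R^-1 * \sum_(i < n) \sum_(k < K)
         (gamma_u ^+ 2 * sqn (\sum_(l < k) eu t i l)
          + gamma_v ^+ 2 * sqn (\sum_(l < k) ev t i l)).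
pose B t := n%:R^-1 * \sum_(i < n) sqn (gu i (x t) (y t i)).
pose phi t := n%:R^-1 * \sum_(i < n) f i (x t) (y t i).
have avg_ge0 (h : 'I_n -> R) : (forall i, 0 <= h i) ->
    0 <= n%:R^-1 * \sum_(i < n) h i.
  by move=> h0; rewrite mulr_ge0 ?invr_ge0// sumr_ge0.
have sqn_avg_ge0 m (z : 'I_n -> 'rV[R]_m) : 0 <= n%:R^-1 * \sum_(i < n) sqn (z i).
  by apply: avg_ge0 => i; exact: sqn_ge0.
have drift_le t : n%:R^-1 * \sum_(i < n)
      \sum_(k < K) (sqn (lx t i k - x t) + sqn (ly t i k - y t i)) <=
    8 * K%:R ^+ 3 * (gamma_u ^+ 2 * B t + gamma ^+ 2 * Q t) + 4 * r t.
  have : n%:R^-1 * \sum_(i < n)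
      \sum_(k < K) (sqn (lx t i k - x t) + sqn (ly t i k - y t i)) <=
    n%:R^-1 * \sum_(i < n) (8 * K%:R ^+ 3 * (gamma_u ^+ 2 * sqn (gu i (x t) (y t i))
       + gamma_v ^+ 2 * sqn (gv i (x t) (y t i))) + 4 * \sum_(k < K)
         (gamma_u ^+ 2 * sqn (\sum_(l < k) eu t i l)
          + gamma_v ^+ 2 * sqn (\sum_(l < k) ev t i l))).
    rewrite ler_wpM2l ?invr_ge0// ler_sum// => i _.
    have := @local_drift _ _ _ (lx t i) (ly t i)
      (fun k => gu i (lx t i k) (ly t i k)) (eu t i)
      (fun k => gv i (lx t i k) (ly t i k)) (ev t i) L gamma_u gamma_v gamma K.
    rewrite /= lx0 ly0; apply => //; rewrite ?(ltW gu0) ?(ltW gv0) ?gug ?gvg//.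
    have s0 : 0 <= gamma * L * K%:R by rewrite !mulr_ge0// ltW.
    have := ler_pM s0 s0 small small; lra.
  move=> /le_trans; apply; rewrite big_split /= -!mulr_sumr big_split /= -!mulr_sumr.
  rewrite mulrDr [n%:R^-1 * (4 * _)]mulrCA -/(r t) lerD2r.
  rewrite mulrCA ler_pM2l ?mulr_gt0 ?exprn_gt0// mulrDr mulrCA -/(B t) lerD2l.
  (* Only the v-gradients are moved into Q, at the price gamma_v <= gamma; the u-gradients keep
     gamma_u in front of B. *)
  rewrite mulrCA; apply: ler_pM; rewrite ?sqr_ge0//.
    by rewrite ler_pXn2r// ?nnegrE ltW.
  by rewrite lerDr sqn_ge0.
have c2 : 0 <= 2 * gamma ^+ 2 by rewrite mulr_ge0// sqr_ge0.
(* Compare with time 0 by the Lipschitz property. Across rounds even the noise is split by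
   Cauchy-Schwarz: the factor T lost here is recovered from gamma_u T <= gamma. *)
have B_le t : (t <= T)%N ->
    B t <= 2 * B 0%N + 8 * L ^+ 2 * gamma ^+ 2 * T%:R * \sum_(s < T) (H s + q s).
  move=> tT.
  have dx : sqn (x t - x 0) <= 2 * gamma ^+ 2 * T%:R *
      \sum_(s < T) (sqn (pu s) + sqn (Nu s)).
    rewrite big_split /= -[leRHS]mulrA [X in _ <= _ * X]mulrDr.
    apply: le_trans (sgd_displacement_le xstep tT) _.
    by rewrite ler_wpM2l ?c2// lerD2l sqn_prefix_sum_le.
  have dy i : sqn (y t i - y 0 i) <= 2 * gamma ^+ 2 * T%:R *
      \sum_(s < T) (sqn (pv s i) + sqn (Nv s i)).
    rewrite big_split /= -[leRHS]mulrA [X in _ <= _ * X]mulrDr.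
    apply: le_trans (@sgd_displacement_le _ _ (y^~ i) (pv^~ i) (Nv^~ i) _ _ _
      (fun s => ystep s i) tT) _.
    rewrite ler_wpM2l ?c2// lerD2l.
    exact: (@sqn_prefix_sum_le _ _ (Nv^~ i)).
  have step i : sqn (gu i (x t) (y t i)) <= 2 * sqn (gu i (x 0) (y 0 i)) +
     8 * L ^+ 2 * gamma ^+ 2 * T%:R *
     (\sum_(s < T) (sqn (pu s) + sqn (Nu s))
      + \sum_(s < T) (sqn (pv s i) + sqn (Nv s i))).
    have := sqnD_le (gu i (x t) (y t i) - gu i (x 0) (y 0 i)) (gu i (x 0) (y 0 i)).
    rewrite subrK.
    have := gu_lip i (x t) (x 0) (y t i) (y 0 i).
    have L2 : 0 <= 4 * L ^+ 2 by rewrite mulr_ge0 ?sqr_ge0.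
    have := ler_wpM2l L2 dx; have := ler_wpM2l L2 (dy i); lra.
  have avg_cst c : n%:R^-1 * \sum_(i < n) c = c :> R.
    by rewrite sumr_const card_ord -[c *+ n]mulr_natl mulrA mulVf ?mul1r ?gt_eqF.
  have : B t <= n%:R^-1 * \sum_(i < n) (2 * sqn (gu i (x 0) (y 0 i)) +
     8 * L ^+ 2 * gamma ^+ 2 * T%:R *
     (\sum_(s < T) (sqn (pu s) + sqn (Nu s))
      + \sum_(s < T) (sqn (pv s i) + sqn (Nv s i)))).
    by rewrite ler_wpM2l ?invr_ge0// ler_sum.
  have lin (S1 S2 c : R) :
    n%:R^-1 * (2 * S1 + c * S2) = 2 * (n%:R^-1 * S1) + c * (n%:R^-1 * S2) by ring.
  move=> /le_trans; apply; rewrite big_split /= -!mulr_sumr lin -/(B 0%N).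
  rewrite lerD2l ler_wpM2l ?mulr_ge0 ?(ltW L0) ?(ltW g0)//.
  rewrite big_split /= mulrDr avg_cst exchange_big /= mulr_sumr -big_split /=.
  apply: ler_sum => s _; rewrite /H /q big_split /=; lra.
have step t : phi t.+1 <= phi t - gamma * K%:R / 2 * Q t - gamma * ell t
    - gamma / (2 * K%:R) * H t + 2 * L * gamma ^+ 2 * (H t + q t)
    + 2 * gamma * L ^+ 2 *
      (8 * K%:R ^+ 3 * (gamma_u ^+ 2 * B t + gamma ^+ 2 * Q t) + 4 * r t).
  rewrite {1}/phi; under eq_bigr do rewrite xstep ystep.
  have h := @round_descent gamma (x t) (y t) (lx t) (eu t) (ly t) (ev t) g0.
  apply: le_trans h _.
  rewrite lerD2l ler_wpM2l ?drift_le// !mulr_ge0// ltW//.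
have tele : phi T <= phi 0%N - gamma * K%:R / 2 * (\sum_(t < T) Q t)
    - gamma * (\sum_(t < T) ell t)
    - gamma / (2 * K%:R) * (\sum_(t < T) H t)
    + 2 * L * gamma ^+ 2 * (\sum_(t < T) H t + \sum_(t < T) q t)
    + 2 * gamma * L ^+ 2 *
      (8 * K%:R ^+ 3 * (gamma_u ^+ 2 * (\sum_(t < T) B t)
                        + gamma ^+ 2 * (\sum_(t < T) Q t)) + 4 * \sum_(t < T) r t).
  elim: T {B_le T0 Te hB T1} => [|S IH]; first by rewrite !big_ord0; lra.
  rewrite !big_ord_recr /=; have := step S; lra.
apply: (@constants_bound K%:R gamma gamma_u eta_u T%:R F0 (B 0%N) _ _
  (\sum_(t < T) H t) _ _ (\sum_(t < T) B t)) => //.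
- by rewrite ltr0n.
- by apply: sumr_ge0 => t _; rewrite addr_ge0 ?sqn_ge0.
- by apply: sumr_ge0 => t _; rewrite addr_ge0 ?sqn_ge0.
- by apply: sumr_ge0 => t _; rewrite addr_ge0 ?sqn_ge0.
- have Hq : \sum_(s < T) (H s + q s) = \sum_(s < T) H s + \sum_(s < T) q s.
    by rewrite big_split.
  have : \sum_(t < T) B t <= \sum_(t < T) (2 * B 0%N +
      8 * L ^+ 2 * gamma ^+ 2 * T%:R * \sum_(s < T) (H s + q s)).
    by apply: ler_sum => t _; apply: B_le; exact: ltnW.
  rewrite sumr_const card_ord -[(_ + _) *+ T]mulr_natl Hq.
  lra.
- have := inf (x T) (y T); rewrite -/(phi T) -/(phi 0%N); lra.
Qed.

End round.

(** * Measurability *)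

Section caratheodory.
Context d (S : measurableType d) (R : realType).

Lemma measurable_countable_union (C : countType) (E : C -> set S) :
  (forall c, measurable (E c)) -> measurable (\bigcup_c E c).
Proof.
move=> mE.
have -> : \bigcup_c E c = \bigcup_k (if unpickle k is Some c then E c else set0).
  apply/seteqP; split => s [k _].
    by exists (pickle k) => //; rewrite pickleK.
  by case: unpickle => // c Es; exists c.
by apply: bigcupT_measurable => k; case: unpickle.
Qed.

Lemma measurable_forall (C : finType) (E : C -> set S) :
  (forall c, measurable (E c)) -> measurable [set s | forall c, E c s].
Proof.
move=> mE.
have -> : [set s | forall c, E c s] = ~` \bigcup_c ~` E c.
  apply/seteqP; split => s /=; first by move=> Es [c _]; apply.
  by move=> Es c; apply: contrapT => nE; apply: Es; exists c.
by apply/measurableC/measurable_countable_union => c; exact/measurableC.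
Qed.

(* [U] is rounded down to the grid (p+1)^-1 Z^m, where it takes countably many
   values; this avoids a measurable structure on row vectors. *)
Lemma measurable_fun_caratheodory (m : nat) (G : S -> 'rV[R]_m -> R)
    (U : S -> 'rV[R]_m) :
  (forall x, measurable_fun setT (G^~ x)) -> (forall s, continuous (G s)) ->
  (forall j, measurable_fun setT (fun s => U s 0 j)) ->
  measurable_fun setT (fun s => G s (U s)).
Proof.
move=> mG cG mU.
pose fl (p : nat) s : 'rV[int]_m := \row_j Num.floor (p.+1%:R * U s 0 j).
pose grid (p : nat) (q : 'rV[int]_m) : 'rV[R]_m := \row_j ((q 0 j)%:~R / p.+1%:R).
apply: (@measurable_fun_cvg _ _ _ _ (fun p s => G s (grid p (fl p s)))).
  move=> p _ B mB; rewrite setTI.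
  have -> : (fun s => G s (grid p (fl p s))) @^-1` B =
      \bigcup_q ([set s | fl p s = q] `&` (G^~ (grid p q)) @^-1` B).
    apply/seteqP; split => s /=; first by move=> Bs; exists (fl p s).
    by move=> [q _ [<-]].
  apply: measurable_countable_union => q; apply: measurableI; last first.
    by rewrite -[X in measurable X]setTI; exact: mG.
  have -> : [set s | fl p s = q] =
     [set s | forall j, ((fun s => p.+1%:R * U s 0 j) @^-1`
        `[(q 0 j)%:~R, (q 0 j + 1)%:~R[) s].
    apply/seteqP; split => s /=.
      by move=> <- j; rewrite /= in_itv /= mxE floor_itv.
    move=> qs; apply/rowP => j; rewrite mxE; apply/eqP.
    by have := qs j; rewrite in_itv /= -floor_eq.
  apply: measurable_forall => j; rewrite -[X in measurable X]setTI.
  by apply: measurable_funM => //; exact: measurable_cst.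
move=> s _; apply: (@cvg_comp _ _ _ _ (G s)); last exact: cG.
apply/cvg_ballP => e e0; near=> p; split => // i j.
rewrite !mxE /ball /= ord1.
have p0 : 0 < p.+1%:R :> R by [].
have /andP[f1 f2] := floor_itv (p.+1%:R * U s 0 j).
have pe : p.+1%:R^-1 < e by near: p; exact: (near_infty_natSinv_lt (PosNum e0)).
have -> : U s 0 j - (Num.floor (p.+1%:R * U s 0 j))%:~R / p.+1%:R =
    (p.+1%:R * U s 0 j - (Num.floor (p.+1%:R * U s 0 j))%:~R) / p.+1%:R.
  by rewrite mulrBl mulrAC divff ?mul1r ?gt_eqF.
rewrite normrM [`|_^-1|]gtr0_norm ?invr_gt0// (le_lt_trans _ pe)// ler_piMl ?invr_ge0//.
move: f2; rewrite ger0_norm ?subr_ge0// intrD; lra.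
Unshelve. all: by end_near.
Qed.

End caratheodory.

Section gradient_measurability.
Context {R : realType}.

(** Along the steps 1 / (p+1) a directional derivative is a limit of a sequence, so measurability of
    the difference quotients passes to it. *)
Lemma derive_seq_cvg (m : nat) (f : 'rV[R]_m -> R) (x v : 'rV[R]_m) :
  derivable f x v ->
  (fun p : nat => p.+1%:R * (f (p.+1%:R^-1 *: v + x) - f x)) @ \oo --> 'D_v f x.
Proof.
move=> df; have := df; rewrite /derivable => /cvg_ex[l fl].
have -> : 'D_v f x = l by exact: cvg_lim.
have hcv : (fun p : nat => p.+1%:R^-1 : R) @ \oo --> (0 : R)^'.
  move=> A /= [e e0 eA].
  apply: filterS (near_infty_natSinv_lt (PosNum e0)) => p pe; apply: eA => /=.
    by rewrite /ball_ /= sub0r normrN gtr0_norm ?invr_gt0.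
  by rewrite invr_eq0 pnatr_eq0.
rewrite (_ : (fun p : nat => _) =
    (fun h => h^-1 *: ((f \o shift x) (h *: v) - f x)) \o (fun p => p.+1%:R^-1)).
  exact: cvg_comp hcv fl.
by apply/funext => p /=; rewrite invrK.
Qed.

Context (dX : measure_display) (Xi : measurableType dX) (du dv : nat).
Variable F : Xi -> 'rV[R]_du -> 'rV[R]_dv -> R.
Hypothesis mF : forall u v, measurable_fun setT (fun z => F z u v).
Hypothesis dFu : forall z u v, differentiable (fun x => F z x v) u.
Hypothesis dFv : forall z u v, differentiable (F z u) v.

(** Separate continuity suffices: the Caratheodory argument in u asks for measurability at each
    fixed u only, and that follows from the same argument in v. *)
Lemma measurable_loss d (S : measurableType d) (Z : S -> Xi)
    (U : S -> 'rV[R]_du) (V : S -> 'rV[R]_dv) :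
  measurable_fun setT Z ->
  (forall j, measurable_fun setT (fun s => U s 0 j)) ->
  (forall j, measurable_fun setT (fun s => V s 0 j)) ->
  measurable_fun setT (fun s => F (Z s) (U s) (V s)).
Proof.
move=> mZ mU mV.
apply: (@measurable_fun_caratheodory _ S R du (fun s u => F (Z s) u (V s))) => //.
- move=> u; apply: (@measurable_fun_caratheodory _ S R dv (fun s => F (Z s) u)) => //.
    by move=> v; exact: (measurableT_comp (mF u v) mZ).
  by move=> s v; exact: differentiable_continuous.
- by move=> s u; exact: (differentiable_continuous (dFu _ _ _)).
Qed.

Context d (S : measurableType d).
Variables (Z : S -> Xi) (U : S -> 'rV[R]_du) (V : S -> 'rV[R]_dv).
Hypothesis mZ : measurable_fun setT Z.
Hypothesis mU : forall j, measurable_fun setT (fun s => U s 0 j).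
Hypothesis mV : forall j, measurable_fun setT (fun s => V s 0 j).

Lemma measurable_grad_u j :
  measurable_fun setT (fun s => grad_u (F (Z s)) (U s) (V s) 0 j).
Proof.
apply: (@measurable_fun_cvg _ _ _ _ (fun (p : nat) s => p.+1%:R *
   (F (Z s) (p.+1%:R^-1 *: delta_mx 0 j + U s) (V s) - F (Z s) (U s) (V s)))).
  move=> p; apply: measurable_funM; first exact: measurable_cst.
  apply: measurable_funB; apply: measurable_loss => // i.
  by under eq_fun do rewrite mxE; apply: measurable_funD.
move=> s _; rewrite /grad_u /grad mxE.
exact: (derive_seq_cvg (f := fun x => F (Z s) x (V s)) (diff_derivable (dFu _ _ _))).
Qed.

Lemma measurable_grad_v j :
  measurable_fun setT (fun s => grad_v (F (Z s)) (U s) (V s) 0 j).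
Proof.
apply: (@measurable_fun_cvg _ _ _ _ (fun (p : nat) s => p.+1%:R *
   (F (Z s) (U s) (p.+1%:R^-1 *: delta_mx 0 j + V s) - F (Z s) (U s) (V s)))).
  move=> p; apply: measurable_funM; first exact: measurable_cst.
  apply: measurable_funB; apply: measurable_loss => // i.
  by under eq_fun do rewrite mxE; apply: measurable_funD.
move=> s _; rewrite /grad_v /grad mxE.
exact: (derive_seq_cvg (f := F (Z s) (U s)) (diff_derivable (dFv _ _ _))).
Qed.

End gradient_measurability.

(** * Independence *)

Section freezing.
Local Open Scope ereal_scope.
Context (R : realType) (d dX : measure_display).
Context (Omega : measurableType d) (Xi : measurableType dX).
Context (P : probability Omega R) (D : probability Xi R).
Variables (G : set (set Omega)) (Y : Omega -> Xi).
Hypothesis Gm : <<s G >> `<=` @measurable _ Omega.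
Hypothesis mY : measurable_fun setT Y.
Hypothesis indepY : forall C B, <<s G >> C -> measurable B ->
  P (C `&` Y @^-1` B) = P C * D B.

(** The law of the identity map into [OG] is the restriction of P to <<s G>>. In this form a
    sub-sigma-algebra can be a factor of a product measure. *)
Let OG : measurableType _ := g_sigma_algebraType G.

Let mid : measurable_fun setT (fun w : Omega => w : OG).
Proof. by move=> _ C mC; rewrite setTI; exact: Gm. Qed.

Let idm : {mfun Omega >-> OG} := mfun_Sub (mem_set mid).

Let mpair : measurable_fun setT (fun w : Omega => (w : OG, Y w)).
Proof. exact: measurable_fun_pair. Qed.

Let pairm : {mfun Omega >-> (OG * Xi)%type} := mfun_Sub (mem_set mpair).

Let joint_law (A : set (OG * Xi)) : measurable A ->
  (distribution P idm \x D) A = distribution P pairm A.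
Proof.
apply: product_measure_unique => C B mC mB.
rewrite /distribution /pushforward /= -indepY//.
Qed.

(** This replaces conditional expectation given <<s G>>: measurability of g on [OG * Xi] says that
    its first argument carries only that information. *)
Lemma freezing_ge0 (g : OG * Xi -> \bar R) :
  measurable_fun setT g -> (forall x, 0 <= g x) ->
  \int[P]_w g (w, Y w) = \int[P]_w \int[D]_z g (w, z).
Proof.
move=> mg g0.
have h1 := @ge0_integral_distribution _ _ _ _ _ P pairm g mg g0.
rewrite -[LHS]h1 (eq_measure_integral (distribution P idm \x D)); last first.
  by move=> A mA _; apply/esym; exact: joint_law.
rewrite fubini_tonelli1//.
rewrite ge0_integral_distribution//.
  exact: measurable_fun_fubini_tonelli_F.
by move=> w; apply: integral_ge0.
Qed.

Lemma freezing (g : OG * Xi -> \bar R) :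
  measurable_fun setT g -> P.-integrable setT (fun w => g (w, Y w)) ->
  \int[P]_w g (w, Y w) = \int[P]_w \int[D]_z g (w, z).
Proof.
move=> mg ig.
have h1 := @integral_distribution _ _ _ _ _ P pairm g mg ig.
(* Fubini for signed g needs integrability under the product; it is transported from P through the
   joint law, which is that product. *)
have ig' : (distribution P idm \x D).-integrable setT g.
  apply/integrableP; split => //.
  rewrite (eq_measure_integral (distribution P pairm)).
    rewrite ge0_integral_distribution//; last exact: measurableT_comp.
    by have /integrableP[] := ig.
  by move=> A mA _; exact: joint_law.
rewrite -[LHS]h1 (eq_measure_integral (distribution P idm \x D)); last first.
  by move=> A mA _; apply/esym; exact: joint_law.
rewrite -integral12_prod_meas1//.
have iF := integrable_fubini_F ig'.
rewrite integral_distribution//; first by case/integrableP: iF.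
have /integrableP[mF iF'] := iF.
apply/integrableP; split; first exact: measurableT_comp mF mid.
rewrite -(@ge0_integral_distribution _ _ _ _ _ P idm (abse \o fubini_F D g))//.
  exact: measurableT_comp.
by move=> y; exact: abse_ge0.
Qed.

End freezing.

Section independence.
Context (R : realType) (d dX : measure_display).
Context (Omega : measurableType d) (Xi : measurableType dX).
Context (P : probability Omega R) (J : finType) (X : J -> Omega -> Xi).
Hypothesis mX : forall j, measurable_fun setT (X j).
Hypothesis indepX : mutually_independent P X.

(* The cylinders leaving [X j] free: a pi-system that generates the
   sigma-algebra of the other variables. *)
Definition other_samples (j : J) : set (set Omega) :=
  [set C | exists2 A : J -> set Xi, forall i, measurable (A i) &
     C = [set w | forall i, i != j -> A i (X i w)]].

Lemma other_samples_measurable j :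
  <<s other_samples j >> `<=` @measurable _ Omega.
Proof.
apply: smallest_sub; first exact: sigma_algebra_measurable.
move=> _ [A mA ->].
rewrite (_ : [set _ | _] =
  [set w | forall i, (if i != j then X i @^-1` A i else setT) w]).
  apply: measurable_forall => i; case: ifP => // _.
  by rewrite -[X in measurable X]setTI; exact: mX.
apply/seteqP; split => w Aw i; first by case: ifPn => // /Aw.
by move=> ij; have := Aw i; rewrite ij.
Qed.

Lemma measurable_other_sample j i : i != j ->
  measurable_fun setT (X i : g_sigma_algebraType (other_samples j) -> Xi).
Proof.
move=> ij _ B mB; rewrite setTI; apply: sub_sigma_algebra.
exists (fun k => if k == i then B else setT); first by move=> k; case: ifP.
apply/seteqP; split => w /=.
  by move=> Bw k kj; case: eqP => // ->.
by move=> /(_ i ij); rewrite eqxx.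
Qed.

(** In C, both sides are finite measures. Mutual independence makes them agree on the cylinders of
    [other_samples], a pi-system containing the whole space, hence they agree on the sigma-algebra
    it generates. *)
Lemma other_samples_independent j C B :
  <<s other_samples j >> C -> measurable B ->
  P (C `&` X j @^-1` B) = (P C * P (X j @^-1` B))%E.
Proof.
move=> sC mB.
have mXB : measurable (X j @^-1` B).
  by rewrite -[X in measurable X]setTI; exact: mX.
have p0 : 0 <= fine (P (X j @^-1` B)) by exact: fine_ge0.
pose m1 : {measure set Omega -> \bar R} := mrestr P mXB.
pose m2 : {measure set Omega -> \bar R} := mscale (NngNum p0) P.
have m2E A : m2 A = (P A * P (X j @^-1` B))%E.
  rewrite -[RHS]muleC -(@fineK _ (P (X j @^-1` B))) ?fin_num_measure//.
have m12 : forall C, other_samples j C -> m1 C = m2 C.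
  move=> _ [A mA ->].
  rewrite m2E -[LHS]/(P ([set w | forall i, i != j -> A i (X i w)] `&` X j @^-1` B)).
  pose A' i := if i == j then B else A i.
  have mA' i : measurable (A' i) by rewrite /A'; case: ifP.
  have := indepX [set~ j]%SET mA'.
  have := indepX [set: J]%SET mA'.
  rewrite (_ : [set w | forall i, i \in [set: J]%SET -> A' i (X i w)] =
     [set w | forall i, i != j -> A i (X i w)] `&` X j @^-1` B); last first.
    apply/seteqP; split => w /=.
      move=> h; split; last by have := h j; rewrite /A' eqxx inE; apply.
      by move=> i ij; have := h i; rewrite /A' (negPf ij) inE; apply.
    move=> [h1 h2] i _; rewrite /A'; case: eqP => [->//|/eqP]; exact: h1.
  rewrite (_ : [set w | forall i, i \in [set~ j]%SET -> A' i (X i w)] =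
     [set w | forall i, i != j -> A i (X i w)]); last first.
    apply/seteqP; split => w /= h i; have := h i; rewrite /A' in_setC1.
      by move=> + ij; rewrite ij (negPf ij); apply.
    by move=> + ij; rewrite ij (negPf ij); apply.
  move=> -> ->; rewrite (bigD1 j)//= /A' eqxx muleC; congr (_ * _)%E.
  by apply: eq_big => i; rewrite ?inE.
have GT : [set A | other_samples j A /\ A `<=` setT] = other_samples j.
  by apply/seteqP; split => A //= [].
have GTT : other_samples j setT.
  by exists (fun=> setT) => //; apply/seteqP; split.
have := @g_sigma_algebra_measure_unique_trace _ R Omega (other_samples j) setT
  measurableT.
rewrite GT => /(_ _ _ m1 m2 _ m12) h.
rewrite -m2E -[LHS]/(m1 C); apply: h => //.
- by move=> A GA; apply: (@other_samples_measurable j); exact: sub_sigma_algebra.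
- move=> _ _ [A mA ->] [A' mA' ->]; exists (fun i => A i `&` A' i).
    by move=> i; exact: measurableI.
  apply/seteqP; split => w /=; first by move=> [h1 h2] i ij; split; auto.
  by move=> h; split => i /h [].
- exact: m12.
- by rewrite -ge0_fin_numE// fin_num_measure.
Qed.

End independence.

(** * Square-integrable noise *)

Section square_integrable.
Context (R : realType) (d : measure_display) (T : measurableType d).
Variable P : probability T R.
Implicit Types X Y : T -> R.

Definition summable X : Prop := P.-integrable setT (EFin \o X).

Definition sq_summable X : Prop :=
  measurable_fun setT X /\ summable (fun w => X w ^+ 2).

Lemma summable_le X Y : measurable_fun setT X ->
  (forall w, `|X w| <= Y w) -> summable Y -> summable X.
Proof.
move=> mX XY; apply: le_integrable => //; first exact/measurable_EFinP.
by move=> w _ /=; rewrite lee_fin (le_trans (XY w))// ler_norm.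
Qed.

Lemma summable_cst c : summable (cst c).
Proof. exact: finite_measure_integrable_cst. Qed.

Lemma summableD X Y : summable X -> summable Y -> summable (fun w => X w + Y w).
Proof. by move=> iX iY; exact: (integrableD _ iX iY). Qed.

Lemma summableZ c X : summable X -> summable (fun w => c * X w).
Proof. by move=> iX; exact: (integrableZl _ _ iX). Qed.

Lemma summable_sum (I : finType) (X : I -> T -> R) :
  (forall i, summable (X i)) -> summable (fun w => \sum_i X i w).
Proof.
move=> iX; have := @integrable_sum _ T R P setT measurableT I (index_enum I) predT
  (fun i => EFin \o X i) (fun i _ => iX i).
by apply: eq_integrable => // w _; rewrite /= sumEFin.
Qed.

Lemma sq_summable_le X Y : measurable_fun setT X ->
  (forall w, X w ^+ 2 <= Y w) -> summable Y -> sq_summable X.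
Proof.
move=> mX XY iY; split => //; apply: summable_le iY.
  exact: measurable_funX.
by move=> w; rewrite ger0_norm ?sqr_ge0.
Qed.

Lemma sq_summable_mul X Y :
  sq_summable X -> sq_summable Y -> summable (fun w => X w * Y w).
Proof.
move=> [mX iX] [mY iY]; apply: summable_le (summableD iX iY).
  exact: measurable_funM.
move=> w; rewrite ler_norml; apply/andP; split.
  by have := sqr_ge0 (X w + Y w); have := sqr_ge0 (X w); have := sqr_ge0 (Y w); lra.
by have := sqr_ge0 (X w - Y w); have := sqr_ge0 (X w); have := sqr_ge0 (Y w); lra.
Qed.

Lemma sq_summable_summable X : sq_summable X -> summable X.
Proof.
move=> [mX iX]; apply: summable_le (summableD (summable_cst 1) iX) => // w.
have := sqr_ge0 (X w - 1); have := sqr_ge0 (X w + 1); have := sqr_ge0 (X w).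
by move=> ? ? ?; rewrite ler_norml; apply/andP; split; rewrite /cst /=; lra.
Qed.

Lemma sq_summable_cst c : sq_summable (cst c).
Proof. by split; [exact: measurable_cst|exact: (summable_cst (c ^+ 2))]. Qed.

Lemma sq_summableD X Y :
  sq_summable X -> sq_summable Y -> sq_summable (fun w => X w + Y w).
Proof.
move=> [mX iX] [mY iY].
apply: sq_summable_le (summableZ 2 (summableD iX iY)).
  exact: measurable_funD.
by move=> w; have := sqr_ge0 (X w - Y w); lra.
Qed.

Lemma sq_summableZ c X : sq_summable X -> sq_summable (fun w => c * X w).
Proof.
move=> [mX iX]; apply: sq_summable_le (summableZ (c ^+ 2) iX).
  exact: measurable_funM.
by move=> w; rewrite exprMn.
Qed.

Lemma sq_summable_sum (I : finType) (X : I -> T -> R) :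
  (forall i, sq_summable (X i)) -> sq_summable (fun w => \sum_i X i w).
Proof.
move=> iX; apply: (@sq_summable_le _ (fun w => #|I|%:R * \sum_i X i w ^+ 2)).
- by apply: measurable_sum => i; case: (iX i).
- by move=> w; exact: sqr_sum_le.
- by apply: summableZ; apply: summable_sum => i; case: (iX i).
Qed.

(** Real-valued, so that expected inequalities are ordinary arithmetic. Since an infinite integral
    would be sent to 0, the link with ['E_P] requires integrability. *)
Definition mean X : R := \int[P]_w X w.

Lemma meanE X : summable X -> 'E_P[X]%E = (mean X)%:E.
Proof.
by move=> iX; rewrite unlock /mean fineK//; exact: integrable_fin_num.
Qed.

Lemma meanD X Y : summable X -> summable Y ->
  mean (fun w => X w + Y w) = mean X + mean Y.
Proof. by move=> iX iY; rewrite /mean RintegralD. Qed.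

Lemma meanZ c X : summable X -> mean (fun w => c * X w) = c * mean X.
Proof. by move=> iX; rewrite /mean RintegralZl. Qed.

Lemma mean_cst c : mean (cst c) = c.
Proof.
have /= h := @Rintegral_cst _ T R P setT measurableT c.
by rewrite /mean h (congr1 fine (@probability_setT _ _ _ P)) mulr1.
Qed.

Lemma mean_le X Y : summable X -> summable Y -> (forall w, X w <= Y w) ->
  mean X <= mean Y.
Proof. by move=> iX iY XY; apply: le_Rintegral. Qed.

Lemma mean_sum (I : finType) (X : I -> T -> R) : (forall i, summable (X i)) ->
  mean (fun w => \sum_i X i w) = \sum_i mean (X i).
Proof.
move=> iX; rewrite /mean /Rintegral.
under eq_integral do rewrite -sumEFin.
rewrite integral_sum//; rewrite -[RHS]/(fine (\sum_i mean (X i))%:E) -sumEFin.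
by congr fine; apply: eq_bigr => i _; rewrite -(meanE (iX i)) unlock.
Qed.

End square_integrable.
Section noise_sum.
Context (R : realType) (d : measure_display) (T : measurableType d).
Variable P : probability T R.

Definition vsq_summable (m : nat) (X : T -> 'rV[R]_m) : Prop :=
  forall c, sq_summable P (fun w => X w 0 c).

Lemma vsq_summable_sqn m (X : T -> 'rV[R]_m) :
  vsq_summable X -> summable P (fun w => sqn (X w)).
Proof. by move=> iX; apply: summable_sum => c; case: (iX c). Qed.

Lemma vsq_summable_dot m (X Y : T -> 'rV[R]_m) :
  vsq_summable X -> vsq_summable Y -> summable P (fun w => dot (X w) (Y w)).
Proof. by move=> iX iY; apply: summable_sum => c; exact: sq_summable_mul. Qed.

Lemma vsq_summable_sum (I : finType) m (X : I -> T -> 'rV[R]_m) :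
  (forall i, vsq_summable (X i)) -> vsq_summable (fun w => \sum_i X i w).
Proof.
move=> iX c; under eq_fun do rewrite summxE.
by apply: sq_summable_sum => i; exact: iX.
Qed.

Lemma vsq_summableZ a m (X : T -> 'rV[R]_m) :
  vsq_summable X -> vsq_summable (fun w => a *: X w).
Proof. by move=> iX c; under eq_fun do rewrite mxE; exact: sq_summableZ. Qed.

Lemma vsq_summableD m (X Y : T -> 'rV[R]_m) :
  vsq_summable X -> vsq_summable Y -> vsq_summable (fun w => X w + Y w).
Proof. by move=> iX iY c; under eq_fun do rewrite mxE; exact: sq_summableD. Qed.

Lemma mean_dot m (X Y : T -> 'rV[R]_m) : vsq_summable X -> vsq_summable Y ->
  (forall c, mean P (fun w => X w 0 c * Y w 0 c) = 0) ->
  mean P (fun w => dot (X w) (Y w)) = 0.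
Proof.
move=> iX iY h; rewrite mean_sum; first by rewrite big1.
by move=> c; exact: sq_summable_mul.
Qed.

(** The cross terms vanish, so the bound is linear in #|I| where Cauchy-Schwarz would give a square.
    With I the set of client-step pairs this is the source of sigma_u^2 / n. *)
Lemma mean_sqn_sum (I : finType) m (e : I -> T -> 'rV[R]_m) (s : R) :
  (forall a, vsq_summable (e a)) ->
  (forall a, mean P (fun w => sqn (e a w)) <= s) ->
  (forall a b c, a != b -> mean P (fun w => e a w 0 c * e b w 0 c) = 0) ->
  mean P (fun w => sqn (\sum_a e a w)) <= #|I|%:R * s.
Proof.
move=> ie es orth.
have -> : mean P (fun w => sqn (\sum_a e a w)) =
    \sum_a mean P (fun w => sqn (e a w)).
  transitivity (\sum_(c < m) \sum_a \sum_b mean P (fun w => e a w 0 c * e b w 0 c)).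
    rewrite mean_sum; last by move=> c; case: (vsq_summable_sum ie c).
    apply: eq_bigr => c _.
    transitivity (mean P (fun w => \sum_a \sum_b e a w 0 c * e b w 0 c)).
      congr mean; apply/funext => w; rewrite summxE expr2 mulr_suml.
      by apply: eq_bigr => a _; rewrite mulr_sumr.
    rewrite mean_sum; last first.
      by move=> a; apply: summable_sum => b; apply: sq_summable_mul; exact: ie.
    apply: eq_bigr => a _; rewrite mean_sum// => b.
    by apply: sq_summable_mul; exact: ie.
  rewrite exchange_big; apply: eq_bigr => a _.
  rewrite mean_sum; last by move=> c; case: (ie a c).
  apply: eq_bigr => c _; rewrite (bigD1 a)//= big1 ?addr0 => [|b ba].
    by congr mean; apply/funext => w; rewrite expr2.
  by apply: orth; rewrite eq_sym.
apply: (le_trans (ler_sum _ (fun a _ => es a))).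
by rewrite sumr_const mulr_natl.
Qed.
End noise_sum.

(** * Lipschitz gradients and measurable iterates *)

Section lipschitz.
Context {R : realType}.

Lemma l2lipschitz_sqn (m p : nat) (c L : R) (g : 'rV[R]_m -> 'rV[R]_p) :
  0 < L -> c <= L -> l2lipschitz c g ->
  forall x y, sqn (g x - g y) <= L ^+ 2 * sqn (x - y).
Proof.
move=> L0 cL h x y; rewrite -!l2norm_sqr -exprMn.
have n0 k (z : 'rV[R]_k) : 0 <= l2norm z by exact: sqrtr_ge0.
rewrite ler_pXn2r ?nnegrE// ?mulr_ge0// ?(ltW L0)//.
by rewrite (le_trans (h x y))// ler_wpM2r.
Qed.

Lemma sqn_lipschitz_continuous (m p : nat) (L : R) (g : 'rV[R]_m -> 'rV[R]_p) c :
  0 < L -> (forall x y, sqn (g x - g y) <= L ^+ 2 * sqn (x - y)) ->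
  continuous (fun x => g x 0 c).
Proof.
move=> L0 h x A /nbhs_ballP[e /= e0 eA].
(* Balls here are those of the sup norm, and sqn (x - y) <= m r^2 on a ball of radius r. Using m+1
   avoids division by zero when m = 0 and makes m < (m+1)^2 strict. *)
have M0 : 0 < L * m.+1%:R by rewrite mulr_gt0.
have d0 : 0 < e / (L * m.+1%:R) by rewrite divr_gt0.
apply/nbhs_ballP; exists (e / (L * m.+1%:R)) => //= y [_ xy]; apply: eA.
rewrite /ball /=.
rewrite -(ltr_pXn2r (n := 2))// ?nnegrE ?(ltW e0)// real_normK ?num_real//.
have -> : g x 0 c - g y 0 c = (g x - g y) 0 c by rewrite !mxE.
have c2 : sqn (x - y) <= m%:R * (e / (L * m.+1%:R)) ^+ 2.
  rewrite /sqn -[X in X%:R * _](card_ord m) mulr_natl -sumr_const ler_sum// => j _.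
  rewrite -[leLHS]real_normK ?num_real// ler_pXn2r ?nnegrE// ?(ltW d0)// !mxE ltW//.
  exact: (xy 0 j).
apply: (le_lt_trans (coord_sqr_le _ c)); apply: (le_lt_trans (h x y)).
have L2 : 0 < L ^+ 2 by rewrite exprn_gt0.
apply: (le_lt_trans (ler_wpM2l (ltW L2) c2)).
have -> : L ^+ 2 * (m%:R * (e / (L * m.+1%:R)) ^+ 2) =
    m%:R / m.+1%:R ^+ 2 * e ^+ 2.
  have : m.+1%:R != 0 :> R by rewrite pnatr_eq0.
  move: (m.+1%:R : R) (m%:R : R) => a b a0.
  by field; rewrite a0 gt_eqF.
rewrite gtr_pMl ?exprn_gt0// ltr_pdivrMr ?exprn_gt0// mul1r -natrX ltr_nat.
by rewrite (leq_trans (ltnSn m))// leq_pmulr.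
Qed.

End lipschitz.

Lemma coordBZ {R : realType} (m : nat) (x g : 'rV[R]_m) a c :
  (x - a *: g) 0 c = x 0 c - a * g 0 c.
Proof. by rewrite !mxE. Qed.

Lemma coordZDZ {R : realType} (m : nat) (x y : 'rV[R]_m) a b c :
  (a *: x + b *: y) 0 c = a * x 0 c + b * y 0 c.
Proof. by rewrite !mxE. Qed.

Section iterates_measurable.
Context (R : realType) (dX : measure_display) (Xi : measurableType dX).
Context (n du dv K : nat).
Variables (F : Xi -> 'rV[R]_du -> 'rV[R]_dv -> R).
Variables (gamma_u gamma_v eta_u eta_v : R).
Hypothesis mF : forall u v, measurable_fun setT (fun z => F z u v).
Hypothesis dFu : forall z u v, differentiable (fun x => F z x v) u.
Hypothesis dFv : forall z u v, differentiable (F z u) v.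

Definition vmeasurable d (S : measurableType d) (m : nat) (U : S -> 'rV[R]_m) :=
  forall c, measurable_fun setT (fun s => U s 0 c).

Context d (S : measurableType d).

(** The domain is arbitrary and only the samples before step k are assumed measurable: with a
    smaller sigma-algebra on Omega, the conclusion then says which samples an iterate does not
    depend on. *)
Lemma local_iter_measurable (z : S -> nat -> Xi) (U : S -> 'rV[R]_du)
    (V : S -> 'rV[R]_dv) (k : nat) :
  (forall l, (l < k)%N -> measurable_fun setT (z^~ l)) ->
  vmeasurable U -> vmeasurable V ->
  vmeasurable (fun s => (local_iter F gamma_u gamma_v (z s) (U s) (V s) k).1) /\
  vmeasurable (fun s => (local_iter F gamma_u gamma_v (z s) (U s) (V s) k).2).
Proof.
move=> mz mU mV; elim: k mz => [//|k IH] mz.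
have [mU' mV'] := IH (fun l lk => mz l (ltnW lk)).
split => c /=.
- under eq_fun do rewrite coordBZ.
  apply: measurable_funB; first exact: mU'.
  apply: measurable_funM; first exact: measurable_cst.
  by apply: measurable_grad_u => //; exact: mz.
- under eq_fun do rewrite coordBZ.
  apply: measurable_funB; first exact: mV'.
  apply: measurable_funM; first exact: measurable_cst.
  by apply: measurable_grad_v => //; exact: mz.
Qed.

Lemma fedavgp_measurable (z : S -> nat -> 'I_n -> nat -> Xi) (u0 : 'rV[R]_du)
    (v0 : 'I_n -> 'rV[R]_dv) (A : nat -> {set 'I_n}) (t : nat)
    (X := fun s => fedavgp F gamma_u gamma_v eta_u eta_v K A (z s) u0 v0 t) :
  (forall r i l, (r < t)%N -> (l < K)%N -> measurable_fun setT (fun s => z s r i l)) ->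
  vmeasurable (fun s => (X s).1) /\ forall i, vmeasurable (fun s => (X s).2 i).
Proof.
rewrite /X {X}; elim: t => [|t IH] mz.
  by split => [c|i c]; exact: measurable_cst.
have [mU mV] := IH (fun r i l rt => mz r i l (ltnW rt)).
have loc i := @local_iter_measurable (fun s => z s t i) _ _ K
  (fun l lK => mz t i l (ltnSn t) lK) mU (mV i).
split => [c|i c] /=.
- under eq_fun do rewrite coordZDZ summxE.
  apply: measurable_funD; apply: measurable_funM; try exact: measurable_cst.
    exact: mU.
  under eq_fun do rewrite -big_enum.
  by apply: measurable_sum => i; exact: (loc i).1.
- case: (i \in A t); last exact: mV.
  under eq_fun do rewrite coordZDZ.
  apply: measurable_funD; apply: measurable_funM; try exact: measurable_cst.
    exact: mV.
  exact: (loc i).2.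
Qed.

Lemma separately_continuous_measurable (h : 'rV[R]_du -> 'rV[R]_dv -> R)
    (U : S -> 'rV[R]_du) (V : S -> 'rV[R]_dv) :
  (forall v, continuous (h^~ v)) -> (forall u, continuous (h u)) ->
  vmeasurable U -> vmeasurable V -> measurable_fun setT (fun s => h (U s) (V s)).
Proof.
move=> hu hv mU mV.
apply: (@measurable_fun_caratheodory _ S R du (fun s u => h u (V s))) => //.
move=> u; apply: (@measurable_fun_caratheodory _ S R dv (fun s => h u)) => //.
Qed.

End iterates_measurable.

(** * Noise of one sample with all the others frozen *)

Section frozen_noise.
Context (R : realType) (d dX : measure_display).
Context (Omega : measurableType d) (Xi : measurableType dX).
Context (P : probability Omega R) (D : probability Xi R).
Variables (G : set (set Omega)) (Y : Omega -> Xi).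
Hypothesis Gm : <<s G >> `<=` @measurable _ Omega.
Hypothesis mY : measurable_fun setT Y.
Hypothesis indepY : forall C B, <<s G >> C -> measurable B ->
  P (C `&` Y @^-1` B) = (P C * D B)%E.

Let OG : measurableType _ := g_sigma_algebraType G.

Lemma sub_sigma_measurable_fun d' (S : measurableType d') (A : OG -> S) :
  measurable_fun setT A -> measurable_fun setT (A : Omega -> S).
Proof. by move=> mA _ B mB; apply: Gm; exact: mA. Qed.

Variables (m : nat) (h : OG -> Xi -> 'rV[R]_m) (s : R).
Hypothesis mh : forall c, measurable_fun setT (fun p : OG * Xi => h p.1 p.2 0 c).
Hypothesis h0 : forall w c, (\int[D]_z (h w z 0 c)%:E = 0)%E.
Hypothesis hs : forall w, (\int[D]_z (sqn (h w z))%:E <= s%:E)%E.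

Let e (w : Omega) : 'rV[R]_m := h w (Y w).

Let me c : measurable_fun setT (fun w => e w 0 c).
Proof.
apply: (measurableT_comp (mh c)
  (_ : measurable_fun setT (fun w : Omega => (w : OG, Y w)))).
apply: measurable_fun_pair => //.
by move=> _ C mC; rewrite setTI; exact: Gm.
Qed.

Let msqn : measurable_fun setT (fun p : OG * Xi => sqn (h p.1 p.2)).
Proof. by apply: measurable_sum => c; apply: measurable_funX. Qed.

(** The Tonelli form of freezing comes first, since it asks for no integrability; it provides the
    square-integrability on which the signed form relies. *)
Let sqn_int_le : (\int[P]_w (sqn (e w))%:E <= s%:E)%E.
Proof.
have := @freezing_ge0 R d dX Omega Xi P D G Y Gm mY indepY
  (fun p => (sqn (h p.1 p.2))%:E).
move=> -> /=; last 2 first.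
- exact/measurable_EFinP.
- by move=> p; rewrite lee_fin sqn_ge0.
have <- : (\int[P]_w (cst s%:E w) = s%:E)%E.
  rewrite integral_cst// [X in (_ * X)%E](_ : _ = 1%E) ?mule1//.
  exact: probability_setT.
apply: ge0_le_integral => //.
- by move=> w _; apply: integral_ge0 => z _; rewrite lee_fin sqn_ge0.
- apply: sub_sigma_measurable_fun.
  apply: (@measurable_fun_fubini_tonelli_F _ _ OG Xi R D
    (fun p : OG * Xi => (sqn (h p.1 p.2))%:E)); first exact/measurable_EFinP.
  by move=> p; rewrite lee_fin sqn_ge0.
Qed.

Let sqn_summable : summable P (fun w => sqn (e w)).
Proof.
apply/integrableP; split.
  by apply/measurable_EFinP; apply: measurable_sum => c; apply: measurable_funX.
under eq_integral do rewrite /= ger0_norm ?sqn_ge0//.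
by apply: (le_lt_trans sqn_int_le); rewrite ltry.
Qed.

Lemma frozen_noise_vsq_summable : vsq_summable P e.
Proof.
move=> c; apply: sq_summable_le sqn_summable => // w; exact: coord_sqr_le.
Qed.

Lemma frozen_noise_variance : mean P (fun w => sqn (e w)) <= s.
Proof. by rewrite -lee_fin -meanE// unlock. Qed.

(** With the outcome frozen, A is a constant factor of the inner integral, and what remains is
    centered. *)
Lemma frozen_noise_orthogonal (A : OG -> R) (c : 'I_m) :
  measurable_fun setT A -> sq_summable P (A : Omega -> R) ->
  mean P (fun w => A w * e w 0 c) = 0.
Proof.
move=> mA sA.
have := @freezing R d dX Omega Xi P D G Y Gm mY indepY
  (fun p => (A p.1 * h p.1 p.2 0 c)%:E).
rewrite /mean /Rintegral => -> /=; last 2 first.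
- apply/measurable_EFinP; apply: measurable_funM => //.
    exact: (measurableT_comp mA measurable_fst).
  exact: mh.
- exact: (sq_summable_mul sA (frozen_noise_vsq_summable c)).
rewrite integral0_eq// => w _.
under eq_integral do rewrite EFinM.
rewrite integralZl//; first by rewrite h0 mule0.
apply: (@sq_summable_summable _ _ _ D).
have mhw q : measurable_fun setT (fun z => h w z 0 q).
  exact: (measurableT_comp (mh q) (@pair1_measurable _ _ OG Xi w)).
apply: (@sq_summable_le _ _ _ _ _ (fun z => sqn (h w z))) => //.
  by move=> z; exact: coord_sqr_le.
apply/integrableP; split.
  by apply/measurable_EFinP; apply: measurable_sum => q; apply: measurable_funX.
under eq_integral do rewrite /= ger0_norm ?sqn_ge0//.
by apply: (le_lt_trans (hs w)); rewrite ltry.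
Qed.

End frozen_noise.

Section centered_oracle.
Context (R : realType) (dX : measure_display) (Xi : measurableType dX).
Variables (D : probability Xi R) (m : nat) (a : Xi -> 'rV[R]_m) (b : 'rV[R]_m).
Variable s : R.
Hypothesis ma : vmeasurable a.
Hypothesis ea : forall c, ('E_D[fun z => a z 0%R c] = (b 0%R c)%:E)%E.
Hypothesis va : ('E_D[fun z => (l2norm (a z - b) ^+ 2)%R] <= s%:E)%E.

Lemma oracle_variance : (\int[D]_z (sqn (a z - b))%:E <= s%:E)%E.
Proof. by move: va; rewrite unlock; under eq_integral do rewrite l2norm_sqr. Qed.

(** The variance bound supplies integrability of the centered coordinates; linearity then turns
    unbiasedness into a zero integral. *)
Lemma oracle_centered c : (\int[D]_z ((a z - b) 0 c)%:E = 0)%E.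
Proof.
have mab q : measurable_fun setT (fun z => (a z - b) 0 q).
  by under eq_fun do rewrite !mxE; apply: measurable_funD.
have iab : summable D (fun z => (a z - b) 0 c).
  apply: sq_summable_summable.
  apply: (@sq_summable_le _ _ _ _ _ (fun z => sqn (a z - b))) => //.
    by move=> z; exact: coord_sqr_le.
  apply/integrableP; split.
    by apply/measurable_EFinP; apply: measurable_sum => q; apply: measurable_funX.
  under eq_integral do rewrite /= ger0_norm ?sqn_ge0//.
  by apply: (le_lt_trans oracle_variance); rewrite ltry.
have ia : summable D (fun z => a z 0 c).
  have := summableD iab (summable_cst D (b 0 c)).
  by apply: eq_integrable => // z _; rewrite /= /cst !mxE subrK.
have e1 : mean D (fun z => a z 0 c) = b 0 c.
  by have := ea c; rewrite meanE// => -[].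
have e2 : mean D (fun z => (a z - b) 0 c) = 0.
  have := meanD iab (summable_cst D (b 0 c)); rewrite mean_cst.
  have -> : (fun w => (a w - b) 0 c + cst (b 0 c) w) = (fun z => a z 0 c).
    by apply/funext => z; rewrite /cst !mxE subrK.
  rewrite e1; lra.
by have := meanE iab; rewrite unlock e2.
Qed.

End centered_oracle.

(** * FedAvg-P as a stochastic process *)

Section process.
Context (R : realType) (d dX : measure_display).
Context (Omega : measurableType d) (Xi : measurableType dX).
Context (P : probability Omega R) (n du dv T K : nat).
Context (D : 'I_n -> probability Xi R).
Variables (F : Xi -> 'rV[R]_du -> 'rV[R]_dv -> R).
Variables (f : 'I_n -> 'rV[R]_du -> 'rV[R]_dv -> R).
Variables (xi : nat -> 'I_n -> nat -> Omega -> Xi).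
Variables (u0 : 'rV[R]_du) (v0 : 'I_n -> 'rV[R]_dv).
Variables (L sigma_u sigma_v gamma_u gamma_v eta_u eta_v : R).
Hypothesis L0 : 0 < L.
Hypothesis n0 : (0 < n)%N.
Hypothesis mF : forall u v, measurable_fun setT (fun z => F z u v).
Hypothesis dFu : forall z u v, differentiable (fun x => F z x v) u.
Hypothesis dFv : forall z u v, differentiable (F z u) v.
Hypothesis hxi : independent_samples P T K D xi.
Hypothesis hgrad : stochastic_gradients D F f sigma_u sigma_v.
Hypothesis luu : forall i u u' v,
  sqn (grad_u (f i) u v - grad_u (f i) u' v) <= L ^+ 2 * sqn (u - u').
Hypothesis luv : forall i u v v',
  sqn (grad_u (f i) u v - grad_u (f i) u v') <= L ^+ 2 * sqn (v - v').
Hypothesis lvu : forall i u u' v,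
  sqn (grad_v (f i) u v - grad_v (f i) u' v) <= L ^+ 2 * sqn (u - u').
Hypothesis lvv : forall i u v v',
  sqn (grad_v (f i) u v - grad_v (f i) u v') <= L ^+ 2 * sqn (v - v').

Definition state t w := fedavgp F gamma_u gamma_v eta_u eta_v K
  (fun _ : nat => [set: 'I_n]%SET) (fun t i k => xi t i k w) u0 v0 t.

Definition iterate t i k w := local_iter F gamma_u gamma_v
  (fun l => xi t i l w) (state t w).1 ((state t w).2 i) k.

Definition noise_u t i k w :=
  grad_u (F (xi t i k w)) (iterate t i k w).1 (iterate t i k w).2
  - grad_u (f i) (iterate t i k w).1 (iterate t i k w).2.

Definition noise_v t i k w :=
  grad_v (F (xi t i k w)) (iterate t i k w).1 (iterate t i k w).2
  - grad_v (f i) (iterate t i k w).1 (iterate t i k w).2.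

Lemma grad_f_measurable d' (S : measurableType d') (U : S -> 'rV[R]_du)
    (V : S -> 'rV[R]_dv) i : vmeasurable U -> vmeasurable V ->
  vmeasurable (fun s => grad_u (f i) (U s) (V s)) /\
  vmeasurable (fun s => grad_v (f i) (U s) (V s)).
Proof.
move=> mU mV; split => c.
  apply: (@separately_continuous_measurable _ _ _ _ _
    (fun u v => grad_u (f i) u v 0 c)) => //.
    move=> v; exact: (@sqn_lipschitz_continuous _ _ _ L
      (fun u => grad_u (f i) u v) c L0 (fun x y => luu i x y v)).
  move=> u; exact: (@sqn_lipschitz_continuous _ _ _ L
      (fun v => grad_u (f i) u v) c L0 (luv i u)).
apply: (@separately_continuous_measurable _ _ _ _ _
    (fun u v => grad_v (f i) u v 0 c)) => //.
  move=> v; exact: (@sqn_lipschitz_continuous _ _ _ L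
      (fun u => grad_v (f i) u v) c L0 (fun x y => lvu i x y v)).
move=> u; exact: (@sqn_lipschitz_continuous _ _ _ L
      (fun v => grad_v (f i) u v) c L0 (lvv i u)).
Qed.

(** [phi] is meant for the identity from Omega equipped with a smaller sigma-algebra, which must
    make only the samples already used measurable. *)
Lemma state_iterate_measurable d' (S : measurableType d') (phi : S -> Omega) t :
  (forall r i l, (r < t)%N -> (l < K)%N -> measurable_fun setT (xi r i l \o phi)) ->
  (vmeasurable (fun s => (state t (phi s)).1) /\
   forall i, vmeasurable (fun s => (state t (phi s)).2 i)) /\
  forall i k, (forall l, (l < k)%N -> measurable_fun setT (xi t i l \o phi)) ->
   vmeasurable (fun s => (iterate t i k (phi s)).1) /\
   vmeasurable (fun s => (iterate t i k (phi s)).2).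
Proof.
move=> mz.
have [mU mV] := @fedavgp_measurable _ _ _ n du dv K F gamma_u gamma_v eta_u eta_v
  mF dFu dFv _ S (fun s t i k => xi t i k (phi s)) u0 v0 (fun=> [set: 'I_n]%SET) t mz.
split => // i k mzk.
exact: (@local_iter_measurable _ _ _ _ _ F gamma_u gamma_v
  mF dFu dFv _ S (fun s l => xi t i l (phi s)) _ _ k mzk mU (mV i)).
Qed.

Lemma noise_measurable d' (S : measurableType d') (phi : S -> Omega) t i k :
  (forall r i l, (r < t)%N -> (l < K)%N -> measurable_fun setT (xi r i l \o phi)) ->
  (forall l, (l <= k)%N -> measurable_fun setT (xi t i l \o phi)) ->
  vmeasurable (fun s => noise_u t i k (phi s)) /\
  vmeasurable (fun s => noise_v t i k (phi s)).
Proof.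
move=> mz mzk.
have [_ /(_ i k (fun l lk => mzk l (ltnW lk))) [mU mV]] := state_iterate_measurable mz.
have [gU gV] := grad_f_measurable i mU mV.
have mk := mzk k (leqnn k).
split => c.
  rewrite /noise_u (_ : (fun _ => _) = fun s =>
    grad_u (F (xi t i k (phi s)))
      (iterate t i k (phi s)).1 (iterate t i k (phi s)).2 0 c
    - grad_u (f i) (iterate t i k (phi s)).1 (iterate t i k (phi s)).2 0 c); last first.
    by apply/funext => s; rewrite [LHS]mxE [X in _ + X]mxE.
  by apply: measurable_funB; [apply: measurable_grad_u|exact: gU].
rewrite /noise_v (_ : (fun _ => _) = fun s =>
    grad_v (F (xi t i k (phi s)))
      (iterate t i k (phi s)).1 (iterate t i k (phi s)).2 0 c
    - grad_v (f i) (iterate t i k (phi s)).1 (iterate t i k (phi s)).2 0 c); last first.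
  by apply/funext => s; rewrite [LHS]mxE [X in _ + X]mxE.
by apply: measurable_funB; [apply: measurable_grad_v|exact: gV].
Qed.

Definition sample (j : 'I_T * 'I_n * 'I_K) := xi j.1.1 j.1.2 j.2.

Lemma sample_measurable j : measurable_fun setT (sample j).
Proof. by case: hxi => mxi _ _; exact: mxi. Qed.

Lemma sample_independent : mutually_independent P sample.
Proof. by case: hxi. Qed.

Section one_sample.
Variables (t : nat) (i : 'I_n) (k : nat).
Hypotheses (tT : (t < T)%N) (kK : (k < K)%N).

Definition rest := other_samples sample (Ordinal tT, i, Ordinal kK).

Lemma other_sample_measurable r i' l : (r < T)%N -> (l < K)%N ->
  [|| r != t, i' != i | l != k] ->
  measurable_fun setT (xi r i' l : g_sigma_algebraType rest -> Xi).
Proof.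
move=> rT lK ne.
have := @measurable_other_sample _ _ _ _ _ sample
  (Ordinal tT, i, Ordinal kK) (Ordinal rT, i', Ordinal lK).
apply; apply: contraTneq ne => -[-> -> ->]; by rewrite !eqxx.
Qed.

Lemma rest_independent C B : <<s rest >> C -> measurable B ->
  P (C `&` xi t i k @^-1` B) = (P C * D i B)%E.
Proof.
move=> sC mB; have [_ law _] := hxi.
have := other_samples_independent sample_measurable sample_independent sC mB.
by rewrite /sample /= law.
Qed.

Lemma rest_past_measurable r i' l : (r < t)%N -> (l < K)%N ->
  measurable_fun setT (xi r i' l \o (id : g_sigma_algebraType rest -> Omega)).
Proof.
move=> rt lK; apply: other_sample_measurable => //; first exact: ltn_trans tT.
by rewrite neq_ltn rt.
Qed.

Lemma rest_state_measurable :
  vmeasurable ((fun w => (state t w).1) : g_sigma_algebraType rest -> _) /\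
  forall i', vmeasurable ((fun w => (state t w).2 i') : g_sigma_algebraType rest -> _).
Proof. by have [] := state_iterate_measurable rest_past_measurable. Qed.

Lemma rest_iterate_measurable :
  vmeasurable ((fun w => (iterate t i k w).1) : g_sigma_algebraType rest -> _) /\
  vmeasurable ((fun w => (iterate t i k w).2) : g_sigma_algebraType rest -> _).
Proof.
have [_] := state_iterate_measurable rest_past_measurable; apply => l lk.
apply: other_sample_measurable => //; first exact: ltn_trans kK.
by rewrite (neq_ltn l) lk /= !orbT.
Qed.

(** Clients do not interact within a round, so the sample (t, i, k) influences neither the noise of
    another client in round t nor the earlier noise of client i. *)
Lemma rest_noise_measurable i' l : (l < K)%N -> (i' != i) || (l < k)%N ->
  vmeasurable (noise_u t i' l : g_sigma_algebraType rest -> _) /\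
  vmeasurable (noise_v t i' l : g_sigma_algebraType rest -> _).
Proof.
move=> lK il; apply: (noise_measurable rest_past_measurable) => q ql.
apply: other_sample_measurable => //; first exact: leq_ltn_trans lK.
case/orP: il => [->|lk]; first by rewrite orbT.
by rewrite (neq_ltn q) (leq_ltn_trans ql lk) !orbT.
Qed.

Let rest_sub := @other_samples_measurable _ _ _ _ _ _ sample_measurable
  (Ordinal tT, i, Ordinal kK).

Let msample : measurable_fun setT (xi t i k).
Proof. exact: (sample_measurable (Ordinal tT, i, Ordinal kK)). Qed.

Let OG : measurableType _ := g_sigma_algebraType rest.

(** The noise with its sample replaced by a free variable. The iterate before step k does not
    involve that sample, so the pair (outcome, sample) can be treated as independent coordinates. *)
Let frozen_measurable :
  (forall c, measurable_fun setT (fun p : OG * Xi =>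
     (grad_u (F p.2) (iterate t i k p.1).1 (iterate t i k p.1).2
      - grad_u (f i) (iterate t i k p.1).1 (iterate t i k p.1).2) 0 c)) /\
  (forall c, measurable_fun setT (fun p : OG * Xi =>
     (grad_v (F p.2) (iterate t i k p.1).1 (iterate t i k p.1).2
      - grad_v (f i) (iterate t i k p.1).1 (iterate t i k p.1).2) 0 c)).
Proof.
have [mU mV] := rest_iterate_measurable.
have mU1 : vmeasurable (fun p : OG * Xi => (iterate t i k p.1).1).
  by move=> c; exact: (measurableT_comp (mU c) measurable_fst).
have mV1 : vmeasurable (fun p : OG * Xi => (iterate t i k p.1).2).
  by move=> c; exact: (measurableT_comp (mV c) measurable_fst).
have [gU gV] := grad_f_measurable i mU1 mV1.
split => c.
  rewrite (_ : (fun _ => _) = fun p : OG * Xi =>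
    grad_u (F p.2) (iterate t i k p.1).1 (iterate t i k p.1).2 0 c
    - grad_u (f i) (iterate t i k p.1).1 (iterate t i k p.1).2 0 c); last first.
    by apply/funext => p; rewrite [LHS]mxE [X in _ + X]mxE.
  by apply: measurable_funB; [apply: measurable_grad_u|exact: gU].
rewrite (_ : (fun _ => _) = fun p : OG * Xi =>
    grad_v (F p.2) (iterate t i k p.1).1 (iterate t i k p.1).2 0 c
    - grad_v (f i) (iterate t i k p.1).1 (iterate t i k p.1).2 0 c); last first.
  by apply/funext => p; rewrite [LHS]mxE [X in _ + X]mxE.
by apply: measurable_funB; [apply: measurable_grad_v|exact: gV].
Qed.

Let msec_u u v : vmeasurable (fun z => grad_u (F z) u v).
Proof.
move=> c.
apply: (@measurable_grad_u _ _ _ _ _ F mF dFu dFv _ _ id (cst u) (cst v)) => // j;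
  exact: measurable_cst.
Qed.

Let msec_v u v : vmeasurable (fun z => grad_v (F z) u v).
Proof.
move=> c.
apply: (@measurable_grad_v _ _ _ _ _ F mF dFu dFv _ _ id (cst u) (cst v)) => // j;
  exact: measurable_cst.
Qed.

Let hu (w : OG) z := grad_u (F z) (iterate t i k w).1 (iterate t i k w).2
      - grad_u (f i) (iterate t i k w).1 (iterate t i k w).2.
Let hv (w : OG) z := grad_v (F z) (iterate t i k w).1 (iterate t i k w).2
      - grad_v (f i) (iterate t i k w).1 (iterate t i k w).2.

Let hu0 w c : (\int[D i]_z (hu w z 0%R c)%:E = 0)%E.
Proof.
have [h1 [_ [h2 _]]] := hgrad i (iterate t i k w).1 (iterate t i k w).2.
exact: (oracle_centered (msec_u _ _) h1 h2).
Qed.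

Let hv0 w c : (\int[D i]_z (hv w z 0%R c)%:E = 0)%E.
Proof.
have [_ [h1 [_ h2]]] := hgrad i (iterate t i k w).1 (iterate t i k w).2.
exact: (oracle_centered (msec_v _ _) h1 h2).
Qed.

Let hus w : (\int[D i]_z (sqn (hu w z))%:E <= (sigma_u ^+ 2)%:E)%E.
Proof.
have [_ [_ [h2 _]]] := hgrad i (iterate t i k w).1 (iterate t i k w).2.
exact: oracle_variance h2.
Qed.

Let hvs w : (\int[D i]_z (sqn (hv w z))%:E <= (sigma_v ^+ 2)%:E)%E.
Proof.
have [_ [_ [_ h2]]] := hgrad i (iterate t i k w).1 (iterate t i k w).2.
exact: oracle_variance h2.
Qed.

Lemma noise_vsq_summable :
  vsq_summable P (noise_u t i k) /\ vsq_summable P (noise_v t i k).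
Proof.
split.
  exact: (frozen_noise_vsq_summable rest_sub msample rest_independent
    frozen_measurable.1 hus).
exact: (frozen_noise_vsq_summable rest_sub msample rest_independent
    frozen_measurable.2 hvs).
Qed.

Lemma noise_variance :
  mean P (fun w => sqn (noise_u t i k w)) <= sigma_u ^+ 2 /\
  mean P (fun w => sqn (noise_v t i k w)) <= sigma_v ^+ 2.
Proof.
split.
  exact: (frozen_noise_variance rest_sub msample rest_independent
    frozen_measurable.1 hus).
exact: (frozen_noise_variance rest_sub msample rest_independent
    frozen_measurable.2 hvs).
Qed.

Lemma noise_orthogonal (A : g_sigma_algebraType rest -> R) :
  measurable_fun setT A -> sq_summable P (A : Omega -> R) ->
  (forall c, mean P (fun w => A w * noise_u t i k w 0 c) = 0) /\
  (forall c, mean P (fun w => A w * noise_v t i k w 0 c) = 0).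
Proof.
move=> mA sA; split => c.
  exact: (frozen_noise_orthogonal rest_sub msample rest_independent
    frozen_measurable.1 hu0 hus).
exact: (frozen_noise_orthogonal rest_sub msample rest_independent
    frozen_measurable.2 hv0 hvs).
Qed.

End one_sample.

Lemma grad_u_lip i u u' v v' :
  sqn (grad_u (f i) u v - grad_u (f i) u' v')
    <= 2 * L ^+ 2 * (sqn (u - u') + sqn (v - v')).
Proof.
have := sqnD_le (grad_u (f i) u v - grad_u (f i) u' v)
  (grad_u (f i) u' v - grad_u (f i) u' v').
rewrite addrA subrK; have := luu i u u' v; have := luv i u' v v'; lra.
Qed.

Lemma grad_v_lip i u u' v v' :
  sqn (grad_v (f i) u v - grad_v (f i) u' v')
    <= 2 * L ^+ 2 * (sqn (u - u') + sqn (v - v')).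
Proof.
have := sqnD_le (grad_v (f i) u v - grad_v (f i) u' v)
  (grad_v (f i) u' v - grad_v (f i) u' v').
rewrite addrA subrK; have := lvu i u u' v; have := lvv i u' v v'; lra.
Qed.

Lemma lipschitz_vsq_summable m (h : 'rV[R]_du -> 'rV[R]_dv -> 'rV[R]_m)
    (U : Omega -> 'rV[R]_du) (V : Omega -> 'rV[R]_dv) :
  (forall u u' v v', sqn (h u v - h u' v')
    <= 2 * L ^+ 2 * (sqn (u - u') + sqn (v - v'))) ->
  vmeasurable (fun w => h (U w) (V w)) ->
  vsq_summable P U -> vsq_summable P V ->
  vsq_summable P (fun w => h (U w) (V w)).
Proof.
move=> hl mh sU sV c.
apply: (@sq_summable_le _ _ _ _ _ (fun w => 2 * sqn (h 0 0) +
    4 * L ^+ 2 * (sqn (U w) + sqn (V w)))); first exact: mh.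
  move=> w; apply: le_trans (coord_sqr_le _ _) _.
  have := sqnD_le (h (U w) (V w) - h 0 0) (h 0 0); rewrite subrK.
  have := hl (U w) 0 (V w) 0; rewrite !subr0; lra.
apply: summableD; first exact: (summable_cst P (2 * sqn (h 0 0))).
by apply/summableZ/summableD; exact: vsq_summable_sqn.
Qed.

Lemma vsq_summable_measurable m (U : Omega -> 'rV[R]_m) :
  vsq_summable P U -> vmeasurable U.
Proof. by move=> sU c; case: (sU c). Qed.

Lemma grad_f_vsq_summable i (U : Omega -> 'rV[R]_du) (V : Omega -> 'rV[R]_dv) :
  vsq_summable P U -> vsq_summable P V ->
  vsq_summable P (fun w => grad_u (f i) (U w) (V w)) /\
  vsq_summable P (fun w => grad_v (f i) (U w) (V w)).
Proof.
move=> sU sV.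
have [mu mv] := grad_f_measurable i (vsq_summable_measurable sU)
  (vsq_summable_measurable sV).
split; first by apply: lipschitz_vsq_summable => //; exact: grad_u_lip.
by apply: lipschitz_vsq_summable => //; exact: grad_v_lip.
Qed.

Lemma iterateS1 t i k w : (iterate t i k.+1 w).1 = (iterate t i k w).1
  - gamma_u *: (grad_u (f i) (iterate t i k w).1 (iterate t i k w).2 + noise_u t i k w).
Proof. by rewrite /noise_u subrKC. Qed.

Lemma iterateS2 t i k w : (iterate t i k.+1 w).2 = (iterate t i k w).2
  - gamma_v *: (grad_v (f i) (iterate t i k w).1 (iterate t i k w).2 + noise_v t i k w).
Proof. by rewrite /noise_v subrKC. Qed.

Lemma stateS1 t w : (state t.+1 w).1 =
  (1 - eta_u) *: (state t w).1 + (eta_u / n%:R) *: \sum_(i < n) (iterate t i K w).1.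
Proof.
rewrite /state /= cardsT card_ord; congr (_ + _ *: _).
by apply: eq_bigl => i; rewrite finset.in_setT.
Qed.

Lemma stateS2 t i w : (state t.+1 w).2 i =
  (1 - eta_v) *: (state t w).2 i + eta_v *: (iterate t i K w).2.
Proof. by rewrite /state /= finset.in_setT. Qed.

(** Lipschitz gradients grow at most linearly and the noise has finite variance, so each local step
    preserves finite second moments. *)
Lemma iterate_vsq_summable t i k : (t < T)%N -> (k <= K)%N ->
  vsq_summable P (fun w => (state t w).1) ->
  vsq_summable P (fun w => (state t w).2 i) ->
  vsq_summable P (fun w => (iterate t i k w).1) /\
  vsq_summable P (fun w => (iterate t i k w).2).
Proof.
move=> tT + sU sV; elim: k => [//|k IH] kK.
have [sx sy] := IH (ltnW kK).
have [gu gv] := grad_f_vsq_summable i sx sy.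
have [nu nv] := noise_vsq_summable i tT kK.
split.
  under eq_fun do rewrite iterateS1 -scaleNr.
  by apply: vsq_summableD => //; apply/vsq_summableZ/vsq_summableD.
under eq_fun do rewrite iterateS2 -scaleNr.
by apply: vsq_summableD => //; apply/vsq_summableZ/vsq_summableD.
Qed.

Lemma state_vsq_summable t : (t <= T)%N ->
  vsq_summable P (fun w => (state t w).1) /\
  forall i, vsq_summable P (fun w => (state t w).2 i).
Proof.
elim: t => [_|t IH tT].
  by split => [c|i c]; exact: (sq_summable_cst P).
have [sU sV] := IH (ltnW tT).
have sI i := iterate_vsq_summable tT (leqnn K) sU (sV i).
split => [|i].
  under eq_fun do rewrite stateS1.
  apply: vsq_summableD; apply: vsq_summableZ => //.
  by apply: vsq_summable_sum => i; case: (sI i).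
under eq_fun do rewrite stateS2.
by apply: vsq_summableD; apply: vsq_summableZ => //; case: (sI i).
Qed.

(** One round at a time is enough, because the pathwise bound contains squared noise sums of single
    rounds only. *)
Lemma noise_uncorrelated t i k i' k' :
  (t < T)%N -> (k < K)%N -> (k' < K)%N -> (i != i') || (k != k') ->
  (forall c, mean P (fun w => noise_u t i k w 0 c * noise_u t i' k' w 0 c) = 0) /\
  (forall c, mean P (fun w => noise_v t i k w 0 c * noise_v t i' k' w 0 c) = 0).
Proof.
move=> tT kK k'K ne.
(* Condition on everything but the later of the two samples. *)
have key j l j' l' : (l < K)%N -> (l' < K)%N -> (j != j') || (l < l')%N ->
    (forall c, mean P (fun w => noise_u t j l w 0 c * noise_u t j' l' w 0 c) = 0) /\
    (forall c, mean P (fun w => noise_v t j l w 0 c * noise_v t j' l' w 0 c) = 0).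
  move=> lK l'K jl.
  have [mu mv] := rest_noise_measurable tT l'K lK jl.
  have [su sv] := noise_vsq_summable j tT lK.
  split => c.
    by have [ou _] := noise_orthogonal (mu c) (su c); exact: ou.
  by have [_ ov] := noise_orthogonal (mv c) (sv c); exact: ov.
(* In the remaining case the client is the same and k' < k, and [key] applies with the two samples
   exchanged. *)
have [|/norP[]] := boolP ((i != i') || (k < k')%N); first exact: key.
rewrite negbK -leqNgt => /eqP ii; rewrite leq_eqVlt ii in ne * => /orP[/eqP kk|kk].
  by move: ne; rewrite kk !eqxx.
have ik : (i' != i') || (k' < k)%N by rewrite kk orbT.
have [h1 h2] := key i' k' i' k k'K kK ik.
split => c.
  by rewrite -(h1 c); congr mean; apply/funext => w; rewrite mulrC.
by rewrite -(h2 c); congr mean; apply/funext => w; rewrite mulrC.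
Qed.

Lemma vmeasurable_client_mean d' (S : measurableType d') m
    (U : 'I_n -> S -> 'rV[R]_m) : (forall i, vmeasurable (U i)) ->
  vmeasurable (fun s => client_mean (fun i => U i s)).
Proof.
move=> mU c; rewrite (_ : (fun _ => _) =
  fun s => n%:R^-1 * \sum_(i < n) U i s 0 c); last first.
  by apply/funext => s; rewrite mxE summxE.
apply: measurable_funM; first exact: measurable_cst.
by apply: measurable_sum => i; exact: mU.
Qed.

Lemma vsq_summable_client_mean m (U : 'I_n -> Omega -> 'rV[R]_m) :
  (forall i, vsq_summable P (U i)) ->
  vsq_summable P (fun w => client_mean (fun i => U i w)).
Proof. by move=> sU; apply: vsq_summableZ; exact: vsq_summable_sum. Qed.

Definition gradient_u t w :=
  client_mean (fun i => grad_u (f i) (state t w).1 ((state t w).2 i)).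
Definition gradient_v t i w := grad_v (f i) (state t w).1 ((state t w).2 i).
Definition round_noise_u t w :=
  client_mean (fun i => \sum_(k < K) noise_u t i k w).
Definition round_noise_v t i w := \sum_(k < K) noise_v t i k w.

Section one_round.
Variables (t : nat).
Hypothesis tT : (t < T)%N.

Lemma gradient_vsq_summable :
  vsq_summable P (gradient_u t) /\ forall i, vsq_summable P (gradient_v t i).
Proof.
have [sU sV] := state_vsq_summable (ltnW tT).
split => [|i]; last by have [] := grad_f_vsq_summable i sU (sV i).
by apply: vsq_summable_client_mean => i; have [] := grad_f_vsq_summable i sU (sV i).
Qed.

Lemma noise_sum_vsq_summable i k : (k <= K)%N ->
  vsq_summable P (fun w => \sum_(l < k) noise_u t i l w) /\
  vsq_summable P (fun w => \sum_(l < k) noise_v t i l w).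
Proof.
move=> kK; split; apply: vsq_summable_sum => l;
  by have [] := noise_vsq_summable i tT (leq_trans (ltn_ord l) kK).
Qed.

Lemma round_noise_vsq_summable :
  vsq_summable P (round_noise_u t) /\ forall i, vsq_summable P (round_noise_v t i).
Proof.
split => [|i]; last by have [] := noise_sum_vsq_summable i (leqnn K).
apply: vsq_summable_client_mean => i.
by have [] := noise_sum_vsq_summable i (leqnn K).
Qed.

Lemma mean_sqn_noise_sum i k : (k <= K)%N ->
  mean P (fun w => sqn (\sum_(l < k) noise_u t i l w)) <= k%:R * sigma_u ^+ 2 /\
  mean P (fun w => sqn (\sum_(l < k) noise_v t i l w)) <= k%:R * sigma_v ^+ 2.
Proof.
move=> kK; have lK (l : 'I_k) : (l < K)%N by exact: leq_trans kK.
rewrite -[X in X%:R * sigma_u ^+ 2]card_ord -[X in X%:R * sigma_v ^+ 2]card_ord.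
split; apply: mean_sqn_sum => [l|l|l l' c ne].
- by have [] := noise_vsq_summable i tT (lK l).
- by have [] := noise_variance i tT (lK l).
- have ll : (i != i) || (l != l' :> nat) by rewrite ne orbT.
  by have [hu hv] := noise_uncorrelated tT (lK l) (lK l') ll.
- by have [] := noise_vsq_summable i tT (lK l).
- by have [] := noise_variance i tT (lK l).
- have ll : (i != i) || (l != l' :> nat) by rewrite ne orbT.
  by have [hu hv] := noise_uncorrelated tT (lK l) (lK l') ll.
Qed.

(** Indexing by client-step pairs lets orthogonality act on all n K noises at once. *)
Lemma round_noise_uE w : round_noise_u t w =
  n%:R^-1 *: \sum_(p : 'I_n * 'I_K) noise_u t p.1 p.2 w.
Proof.
rewrite /round_noise_u /client_mean.
by rewrite (pair_bigA _ (fun i (k : 'I_K) => noise_u t i k w)).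
Qed.

Lemma mean_sqn_round_noise_u :
  mean P (fun w => sqn (round_noise_u t w)) <= K%:R * (sigma_u ^+ 2 / n%:R).
Proof.
have sE : vsq_summable P (fun w => \sum_(p : 'I_n * 'I_K) noise_u t p.1 p.2 w).
  by apply: vsq_summable_sum => p; have [] := noise_vsq_summable p.1 tT (ltn_ord p.2).
rewrite (_ : (fun _ => _) = fun w => n%:R^-1 ^+ 2 *
    sqn (\sum_(p : 'I_n * 'I_K) noise_u t p.1 p.2 w)); last first.
  by apply/funext => w; rewrite round_noise_uE sqnZ.
rewrite meanZ; last exact: vsq_summable_sqn.
have -> : K%:R * (sigma_u ^+ 2 / n%:R) =
    n%:R^-1 ^+ 2 * (#|{: 'I_n * 'I_K}|%:R * sigma_u ^+ 2).
  rewrite card_prod !card_ord natrM; field.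
  by rewrite pnatr_eq0 -lt0n.
rewrite ler_wpM2l ?sqr_ge0//; apply: mean_sqn_sum => [p|p|[i k] [i' k'] c ne].
- by have [] := noise_vsq_summable p.1 tT (ltn_ord p.2).
- by have [] := noise_variance p.1 tT (ltn_ord p.2).
- have ll : (i != i') || (k != k' :> nat) by rewrite -negb_and -xpair_eqE.
  by have [hu hv] := noise_uncorrelated tT (ltn_ord k) (ltn_ord k') ll.
Qed.

Lemma mean_dot_sum (I : finType) m (X : Omega -> 'rV[R]_m)
    (Y : I -> Omega -> 'rV[R]_m) :
  vsq_summable P X -> (forall a, vsq_summable P (Y a)) ->
  (forall a, mean P (fun w => dot (X w) (Y a w)) = 0) ->
  mean P (fun w => dot (X w) (\sum_a Y a w)) = 0.
Proof.
move=> sX sY h.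
rewrite (_ : (fun _ => _) = fun w => \sum_a dot (X w) (Y a w)); last first.
  apply/funext => w; rewrite /dot exchange_big; apply: eq_bigr => c _.
  by rewrite summxE mulr_sumr.
by rewrite mean_sum ?big1// => a; exact: vsq_summable_dot.
Qed.

(** Gradients at the start of round t involve earlier rounds only, so they are measurable with
    respect to all samples other than (t, i, k). *)
Lemma mean_dot_noise i k i' : (k < K)%N ->
  mean P (fun w => dot (gradient_u t w) (noise_u t i k w)) = 0 /\
  mean P (fun w => dot (gradient_v t i' w) (noise_v t i k w)) = 0.
Proof.
move=> kK; have [sG sg] := gradient_vsq_summable.
have [su sv] := noise_vsq_summable i tT kK.
have [mU mV] := rest_state_measurable i tT kK.
split; apply: mean_dot => // c.
  have [h _] := @noise_orthogonal t i k tT kK (fun w => gradient_u t w 0 c)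
    (@vmeasurable_client_mean _ _ _ _
      (fun i => (grad_f_measurable i mU (mV i)).1) c) (sG c).
  exact: h.
have [_ h] := @noise_orthogonal t i k tT kK (fun w => gradient_v t i' w 0 c)
  ((grad_f_measurable i' mU (mV i')).2 c) (sg i' c).
exact: h.
Qed.

Lemma mean_dot_round_noise_u :
  mean P (fun w => dot (gradient_u t w) (round_noise_u t w)) = 0.
Proof.
have [sG _] := gradient_vsq_summable.
rewrite (_ : (fun _ => _) = fun w => n%:R^-1 *
    dot (gradient_u t w) (\sum_(p : 'I_n * 'I_K) noise_u t p.1 p.2 w)); last first.
  by apply/funext => w; rewrite round_noise_uE dotZr.
have sp (p : 'I_n * 'I_K) : vsq_summable P (noise_u t p.1 p.2).
  by have [] := noise_vsq_summable p.1 tT (ltn_ord p.2).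
rewrite meanZ; last first.
  by apply: vsq_summable_dot => //; exact: vsq_summable_sum.
rewrite mean_dot_sum ?mulr0// => p.
by have [] := mean_dot_noise p.1 p.1 (ltn_ord p.2).
Qed.

Lemma mean_dot_round_noise_v i :
  mean P (fun w => dot (gradient_v t i w) (round_noise_v t i w)) = 0.
Proof.
have [_ sg] := gradient_vsq_summable.
apply: mean_dot_sum => // k.
  by have [] := noise_vsq_summable i tT (ltn_ord k).
by have [] := mean_dot_noise i i (ltn_ord k).
Qed.

End one_round.

(** * Expectation of the pathwise bound *)

Section expectation.
Variables (gamma F0 : R).
Hypotheses (T0 : (0 < T)%N) (K0 : (0 < K)%N).
Hypothesis dfu : forall i u v, differentiable (fun x => f i x v) u.
Hypothesis dfv : forall i u v, differentiable (f i u) v.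
Hypotheses (gu0 : 0 < gamma_u) (gv0 : 0 < gamma_v).
Hypotheses (eu0 : 0 < eta_u) (ev0 : 0 < eta_v).
Hypotheses (geu : gamma_u * eta_u = gamma) (gev : gamma_v * eta_v = gamma).
Hypothesis small : gamma * L * K%:R <= 1 / 84.
Hypothesis F00 : 0 < F0.
Hypotheses (eT : T%:R <= eta_u) (en : n%:R <= eta_u ^+ 2) (ev1 : 1 <= eta_v).
Hypothesis eB : n%:R^-1 * (\sum_(i < n) sqn (grad_u (f i) u0 (v0 i))) * T%:R
    <= L * F0 * eta_u ^+ 2.
Hypothesis f_inf : forall u v, n%:R^-1 * (\sum_(i < n) f i u0 (v0 i)) - F0
    <= n%:R^-1 * \sum_(i < n) f i u (v i).

Let drift_noise t w := n%:R^-1 * \sum_(i < n) \sum_(k < K)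
  (gamma_u ^+ 2 * sqn (\sum_(l < k) noise_u t i l w)
   + gamma_v ^+ 2 * sqn (\sum_(l < k) noise_v t i l w)).

Let g2 t w := sqn (gradient_u t w) + n%:R^-1 * \sum_(i < n) sqn (gradient_v t i w).

Let ell t w := dot (gradient_u t w) (round_noise_u t w)
  + n%:R^-1 * \sum_(i < n) dot (gradient_v t i w) (round_noise_v t i w).

Let q t w := sqn (round_noise_u t w)
  + n%:R^-1 * \sum_(i < n) sqn (round_noise_v t i w).

Let pathwise w : \sum_(t < T) g2 t w <=
  4 * F0 / (gamma * K%:R) + L * F0 - 4 / K%:R * (\sum_(t < T) ell t w)
  + 12 * L * gamma / K%:R * (\sum_(t < T) q t w)
  + 32 * L ^+ 2 / K%:R * (\sum_(t < T) drift_noise t w).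
Proof.
apply: (@fedavgp_pathwise R n du dv f (fun i => grad_u (f i)) (fun i => grad_v (f i))
  L K n0 K0 L0 _ grad_u_lip grad_v_lip T gamma_u gamma_v eta_u eta_v gamma F0
  (fun t => (state t w).1) (fun t => (state t w).2)
  (fun t i k => (iterate t i k w).1) (fun t i k => noise_u t i k w)
  (fun t i k => (iterate t i k w).2) (fun t i k => noise_v t i k w)) => //.
- by move=> i u a v b; apply: descent2 => //.
- by move=> t i k; rewrite iterateS1.
- by move=> t i k; rewrite iterateS2.
- by move=> t; rewrite stateS1.
- by move=> t i; rewrite stateS2.
Qed.

Let avg_summable (X : 'I_n -> Omega -> R) : (forall i, summable P (X i)) ->
  summable P (fun w => n%:R^-1 * \sum_(i < n) X i w).
Proof. by move=> sX; apply: summableZ; exact: summable_sum. Qed.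

Let mean_avg (X : 'I_n -> Omega -> R) : (forall i, summable P (X i)) ->
  mean P (fun w => n%:R^-1 * \sum_(i < n) X i w) = n%:R^-1 * \sum_(i < n) mean P (X i).
Proof.
move=> sX; rewrite meanZ; last exact: summable_sum.
by rewrite mean_sum.
Qed.

Let avg_cst (c : R) : n%:R^-1 * \sum_(i < n) c = c.
Proof.
by rewrite sumr_const card_ord -[c *+ n]mulr_natl mulrA mulVf ?mul1r ?pnatr_eq0 -?lt0n.
Qed.

Let g2_summable (t : 'I_T) : summable P (g2 t).
Proof.
have [sG sg] := gradient_vsq_summable (ltn_ord t).
apply: summableD; first exact: vsq_summable_sqn.
by apply: avg_summable => i; exact: vsq_summable_sqn.
Qed.

Let ell_summable (t : 'I_T) : summable P (ell t).
Proof.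
have [sG sg] := gradient_vsq_summable (ltn_ord t).
have [sN sn] := round_noise_vsq_summable (ltn_ord t).
apply: summableD; first exact: vsq_summable_dot.
by apply: avg_summable => i; exact: vsq_summable_dot.
Qed.

Let q_summable (t : 'I_T) : summable P (q t).
Proof.
have [sN sn] := round_noise_vsq_summable (ltn_ord t).
apply: summableD; first exact: vsq_summable_sqn.
by apply: avg_summable => i; exact: vsq_summable_sqn.
Qed.

Let drift_term_summable (t : 'I_T) i (k : 'I_K) :
  summable P (fun w => gamma_u ^+ 2 * sqn (\sum_(l < k) noise_u t i l w)
   + gamma_v ^+ 2 * sqn (\sum_(l < k) noise_v t i l w)).
Proof.
have [sU sV] := noise_sum_vsq_summable (ltn_ord t) i (ltnW (ltn_ord k)).
by apply: summableD; apply: summableZ; exact: vsq_summable_sqn.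
Qed.

Let drift_summable (t : 'I_T) : summable P (drift_noise t).
Proof.
by apply: avg_summable => i; apply: summable_sum => k; exact: drift_term_summable.
Qed.

Let sigma2 := sigma_u ^+ 2 / n%:R + sigma_v ^+ 2.

Let mean_ell (t : 'I_T) : mean P (ell t) = 0.
Proof.
have [sG sg] := gradient_vsq_summable (ltn_ord t).
have [sN sn] := round_noise_vsq_summable (ltn_ord t).
rewrite meanD; last 2 first.
- exact: vsq_summable_dot.
- by apply: avg_summable => i; exact: vsq_summable_dot.
rewrite mean_avg; last by move=> i; exact: vsq_summable_dot.
rewrite mean_dot_round_noise_u// big1 ?mulr0 ?addr0// => i _.
exact: mean_dot_round_noise_v.
Qed.

Let mean_q (t : 'I_T) : mean P (q t) <= K%:R * sigma2.
Proof.
have [sN sn] := round_noise_vsq_summable (ltn_ord t).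
rewrite meanD; last 2 first.
- exact: vsq_summable_sqn.
- by apply: avg_summable => i; exact: vsq_summable_sqn.
rewrite mean_avg; last by move=> i; exact: vsq_summable_sqn.
rewrite mulrDr lerD ?mean_sqn_round_noise_u//.
rewrite -[leRHS]avg_cst ler_wpM2l ?invr_ge0// ler_sum// => i _.
by have [] := mean_sqn_noise_sum (ltn_ord t) i (leqnn K).
Qed.

Let mean_drift (t : 'I_T) :
  mean P (drift_noise t) <= K%:R ^+ 2 * gamma ^+ 2 * sigma2.
Proof.
(* eta_u >= sqrt n enters here: it gives the drift of each single client the factor 1/n that
   averaging gives the round noise. *)
have gu2 : gamma_u ^+ 2 <= gamma ^+ 2 / n%:R.
  rewrite ler_pdivlMr ?ltr0n// -geu exprMn ler_wpM2l ?sqr_ge0//.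
have gv2 : gamma_v ^+ 2 <= gamma ^+ 2.
  have gvg : gamma_v <= gamma by rewrite -gev ler_peMr// ltW.
  have := ler_pM (ltW gv0) (ltW gv0) gvg gvg; lra.
rewrite mean_avg; last first.
  by move=> i; apply: summable_sum => k; exact: drift_term_summable.
rewrite -[leRHS]avg_cst ler_wpM2l ?invr_ge0// ler_sum// => i _.
rewrite mean_sum; last by move=> k; exact: drift_term_summable.
(* A partial sum of k noises has variance of order k, bounded by K; summing over the K local steps
   gives K^2. *)
have -> : K%:R ^+ 2 * gamma ^+ 2 * sigma2 =
    \sum_(k < K) (K%:R * (gamma ^+ 2 * sigma2)).
  by rewrite sumr_const card_ord -[(K%:R * _) *+ K]mulr_natl; ring.
apply: ler_sum => k _.
have [sU sV] := noise_sum_vsq_summable (ltn_ord t) i (ltnW (ltn_ord k)).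
rewrite meanD; [|by apply: summableZ; exact: vsq_summable_sqn..].
rewrite !meanZ; [|exact: vsq_summable_sqn..].
have [mU mV] := mean_sqn_noise_sum (ltn_ord t) i (ltnW (ltn_ord k)).
have kK : k%:R <= K%:R :> R by rewrite ler_nat ltnW.
have h1 := ler_wpM2l (sqr_ge0 gamma_u) mU; have h2 := ler_wpM2l (sqr_ge0 gamma_v) mV.
have ku0 : 0 <= k%:R * sigma_u ^+ 2 by rewrite mulr_ge0 ?sqr_ge0.
have kv0 : 0 <= k%:R * sigma_v ^+ 2 by rewrite mulr_ge0 ?sqr_ge0.
have h3 := ler_wpM2r ku0 gu2; have h4 := ler_wpM2r kv0 gv2.
have s20 : 0 <= gamma ^+ 2 * sigma2.
  by rewrite mulr_ge0 ?sqr_ge0// addr_ge0 ?divr_ge0 ?sqr_ge0.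
have h5 := ler_wpM2r s20 kK.
have e : gamma ^+ 2 / n%:R * (k%:R * sigma_u ^+ 2) + gamma ^+ 2 * (k%:R * sigma_v ^+ 2)
   = k%:R * (gamma ^+ 2 * sigma2) by rewrite /sigma2; ring.
lra.
Qed.

Lemma expected_gradients_le :
  \sum_(t < T) (mean P (fun w => sqn (gradient_u t w))
                + n%:R^-1 * \sum_(i < n) mean P (fun w => sqn (gradient_v t i w)))
  <= 4 * F0 / (gamma * K%:R) + L * F0 + T%:R * (44 * L * sigma2 * gamma).
Proof.
have Kr0 : 0 < K%:R :> R by rewrite ltr0n.
have g0 : 0 < gamma by rewrite -geu mulr_gt0.
have sum_summable (X : nat -> Omega -> R) : (forall t : 'I_T, summable P (X t)) ->
    summable P (fun w => \sum_(t < T) X t w).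
  by move=> sX; exact: summable_sum.
have -> : \sum_(t < T) (mean P (fun w => sqn (gradient_u t w))
    + n%:R^-1 * \sum_(i < n) mean P (fun w => sqn (gradient_v t i w))) =
    mean P (fun w => \sum_(t < T) g2 t w).
  rewrite mean_sum//; apply: eq_bigr => t _.
  have [sG sg] := gradient_vsq_summable (ltn_ord t).
  rewrite meanD; last 2 first.
  - exact: vsq_summable_sqn.
  - by apply: avg_summable => i; exact: vsq_summable_sqn.
  by rewrite mean_avg// => i; exact: vsq_summable_sqn.
have s1 := summable_cst P (4 * F0 / (gamma * K%:R) + L * F0).
have s2 := summableZ (- (4 / K%:R)) (sum_summable ell ell_summable).
have s3 := summableZ (12 * L * gamma / K%:R) (sum_summable q q_summable).
have s4 := summableZ (32 * L ^+ 2 / K%:R) (sum_summable drift_noise drift_summable).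
have := mean_le (sum_summable g2 g2_summable)
  (summableD (summableD (summableD s1 s2) s3) s4) _.
move=> /(_ _)/le_trans; apply.
  by move=> w; have := pathwise w; rewrite /cst; lra.
rewrite (meanD (summableD (summableD s1 s2) s3) s4) (meanD (summableD s1 s2) s3).
rewrite (meanD s1 s2) mean_cst.
rewrite !meanZ; try exact: sum_summable.
rewrite !mean_sum//.
rewrite big1 ?mulr0 ?addr0; last by move=> t _; exact: mean_ell.
have cst_sum (c : R) : \sum_(t < T) c = T%:R * c.
  by rewrite sumr_const card_ord mulr_natl.
have hq : \sum_(t < T) mean P (q t) <= T%:R * (K%:R * sigma2).
  by rewrite -cst_sum ler_sum.
have hr : \sum_(t < T) mean P (drift_noise t) <=
    T%:R * (K%:R ^+ 2 * gamma ^+ 2 * sigma2).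
  by rewrite -cst_sum ler_sum.
have c1 : 0 <= 12 * L * gamma / K%:R by rewrite !mulr_ge0 ?invr_ge0 ?(ltW L0) ?(ltW g0).
have c2 : 0 <= 32 * L ^+ 2 / K%:R by rewrite !mulr_ge0 ?invr_ge0 ?(ltW L0).
have h1 := ler_wpM2l c1 hq; have h2 := ler_wpM2l c2 hr.
have e1 : 12 * L * gamma / K%:R * (T%:R * (K%:R * sigma2)) =
  12 * (T%:R * (L * gamma * sigma2)) by field; rewrite gt_eqF.
have e2 : 32 * L ^+ 2 / K%:R * (T%:R * (K%:R ^+ 2 * gamma ^+ 2 * sigma2)) =
  32 * ((gamma * L * K%:R) * (T%:R * (L * gamma * sigma2))).
  by field; rewrite gt_eqF.
have s20 : 0 <= T%:R * (L * gamma * sigma2).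
  rewrite !mulr_ge0 ?(ltW L0) ?(ltW g0)//.
  by rewrite addr_ge0 ?divr_ge0 ?sqr_ge0.
(* The drift noise has coefficient 32 gamma L K <= 32/84; added to the 12 of the round noise, it
   stays below 44. *)
have h3 := ler_wpM2r s20 small.
lra.
Qed.

End expectation.

End process.

(** * Global gradient, choice of step size and final bounds *)

Lemma grad_u_global_obj (R : realType) (n du dv : nat)
    (f : 'I_n -> 'rV[R]_du -> 'rV[R]_dv -> R) (u : 'rV[R]_du)
    (v : 'I_n -> 'rV[R]_dv) :
  (forall i u v, differentiable (fun x => f i x v) u) ->
  grad_u (global_obj f) u v = client_mean (fun i => grad_u (f i) u (v i)).
Proof.
move=> df; apply/rowP => j; rewrite /grad_u /grad !mxE summxE.
have -> : (fun x => global_obj f x v) = n%:R^-1 *: \sum_(i < n) (fun x => f i x (v i)).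
  by apply/funext => x; rewrite /global_obj /= fct_sumE.
have dj i : derivable (fun x => f i x (v i)) u (delta_mx 0 j).
  by apply: diff_derivable; exact: df.
rewrite deriveZ; last by apply: derivable_sum => i; exact: dj.
rewrite derive_sum//; congr (_ * _); by apply: eq_bigr => i _; rewrite mxE.
Qed.

(** Write rho for the square root on the right. The prescribed gamma makes the first term exactly
    336 L F0 / t + 4 rho, and r rho = 11 L s with gamma r <= 1 bounds the second by 4 rho; the
    remaining L F0 / t raises 336 to 337. *)
Lemma step_size_bound (R : realType) (L F0 k t s gamma : R)
    (r := Num.sqrt (11 * L * k * t / F0 * s)) :
  0 < L -> 0 < F0 -> 0 < k -> 0 < t -> 0 <= s ->
  gamma = (84 * L * k + r)^-1 ->
  4 * F0 / (t * k * gamma) + 44 * L * s * gamma + L * F0 / t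
    <= 8 * Num.sqrt (11 * L * F0 / (k * t) * s) + 337 * L * F0 / t.
Proof.
move=> L0 F00 k0 t0 s0 ge.
set rho := Num.sqrt (11 * L * F0 / (k * t) * s).
have r0 : 0 <= r by exact: sqrtr_ge0.
have rho0 : 0 <= rho by exact: sqrtr_ge0.
have a0 : 0 < 84 * L * k by rewrite !mulr_gt0.
have ar0 : 0 < 84 * L * k + r by rewrite ltr_wpDr.
have e1 : rho = F0 / (t * k) * r.
  have c0 : 0 <= F0 / (t * k) by rewrite divr_ge0 ?mulr_ge0 ?ltW.
  rewrite -{1}(ger0_norm c0) -sqrtr_sqr /r -sqrtrM ?sqr_ge0// /rho; congr Num.sqrt.
  by field; rewrite !gt_eqF.
have e2 : r * rho = 11 * L * s.
  rewrite e1 mulrCA -expr2 sqr_sqrtr; first by field; rewrite !gt_eqF.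
  by rewrite mulr_ge0// divr_ge0 ?mulr_ge0 ?ltW.
have e3 : 4 * F0 / (t * k * gamma) = 336 * L * F0 / t + 4 * rho.
  by rewrite e1 ge; field; rewrite !gt_eqF.
have h : 11 * L * s * gamma <= rho.
  rewrite -e2 ge ler_pdivrMr// [leLHS]mulrC ler_wpM2l//.
  by rewrite lerDr ltW.
rewrite e3; lra.
Qed.

Theorem theorem3p11
  (R : realType)
  (d dX : measure_display) (Omega : measurableType d) (Xi : measurableType dX)
  (P : probability Omega R)
  (n du dv T K : nat)
  (hn : (1 <= n)%N) (hT : (1 <= T)%N) (hK : (1 <= K)%N)
  (D : 'I_n -> probability Xi R)
  (F : Xi -> 'rV[R]_du -> 'rV[R]_dv -> R)
  (hF : regular_loss D F)
  (xi : nat -> 'I_n -> nat -> Omega -> Xi)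
  (hxi : independent_samples P T K D xi)
  (u0 : 'rV[R]_du) (v0 : 'I_n -> 'rV[R]_dv)
  (Lu Lv Luv Lvu L sigma_u sigma_v F0 : R)
  (gamma_u gamma_v eta_u eta_v gamma : R)
  (hsmooth : smooth (client_obj D F) Lu Lv Luv Lvu)
  (hL : L = Num.max (Num.max Lu Lv) (Num.max Luv Lvu))
  (hL0 : 0 < L)
  (hgrad : stochastic_gradients D F (client_obj D F) sigma_u sigma_v)
  (hF0 : obj_gap (client_obj D F) u0 v0 = F0%:E)
  (hF00 : 0 < F0)
  (hgu : 0 < gamma_u) (hgv : 0 < gamma_v) (heu : 0 < eta_u) (hev : 0 < eta_v)
  (hgamma_u : gamma_u * eta_u = gamma) (hgamma_v : gamma_v * eta_v = gamma) :
  let f := client_obj D F in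
  let X (t : nat) (w : Omega) :=
    fedavgp F gamma_u gamma_v eta_u eta_v K (fun _ : nat => [set: 'I_n]%SET)
      (fun t i k => xi t i k w) u0 v0 t in
  let B0 := \sum_(i < n) l2norm (grad_u (f i) u0 (v0 i)) ^+ 2 in
  let avg := ((T%:R^-1)%:E * \sum_(0 <= t < T) (Gu P f (X t) + Gv P f (X t)))%E in
  let sigma2 := sigma_u ^+ 2 / n%:R + sigma_v ^+ 2 in
  Num.max T%:R (Num.max (Num.sqrt (B0 * T%:R / (n%:R * L * F0)))
                        (Num.sqrt n%:R)) <= eta_u ->
  1 <= eta_v ->
  gamma <= 1 / (84 * L * K%:R) ->
  (avg <= (4 * F0 / (T%:R * K%:R * gamma) + 44 * L * sigma2 * gamma
           + L * F0 / T%:R)%:E)%E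
  /\
  (gamma = (84 * L * K%:R
            + Num.sqrt (11 * L * K%:R * T%:R / F0 * sigma2))^-1 ->
   (avg <= (8 * Num.sqrt (11 * L * F0 / (K%:R * T%:R) * sigma2)
            + 337 * L * F0 / T%:R)%:E)%E).
Proof.
move=> f X B0 avg sigma2 heta hev1 hgam.
have nr0 : 0 < n%:R :> R by rewrite ltr0n.
have Tr0 : 0 < T%:R :> R by rewrite ltr0n.
have Kr0 : 0 < K%:R :> R by rewrite ltr0n.
have B00 : 0 <= B0 by apply: sumr_ge0 => i _; exact: sqr_ge0.
have s20 : 0 <= sigma2 by rewrite addr_ge0 ?divr_ge0 ?sqr_ge0.
have g0 : 0 < gamma by rewrite -hgamma_u mulr_gt0.
have [hT1 hB hn1] : [/\ T%:R <= eta_u,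
    Num.sqrt (B0 * T%:R / (n%:R * L * F0)) <= eta_u & Num.sqrt n%:R <= eta_u].
  by move: heta; rewrite !ge_max => /andP[-> /andP[-> ->]].
have eta2 (a : R) : 0 <= a -> Num.sqrt a <= eta_u -> a <= eta_u ^+ 2.
  move=> a0 h; rewrite -(sqr_sqrtr a0) ler_pXn2r ?nnegrE ?sqrtr_ge0//.
  exact: ltW.
have [LuL LvL LuvL LvuL] : [/\ Lu <= L, Lv <= L, Luv <= L & Lvu <= L].
  by rewrite hL !le_max !lexx !orbT.
have [iF dFu dFv] := hF.
(* Measurability in the sample is read off from integrability under the law of one client, which
   exists as n >= 1. *)
have mF u v : measurable_fun setT (fun z => F z u v).
  by apply/measurable_EFinP; case/integrableP: (iF (Ordinal hn) u v).
have dfu i u v : differentiable (fun x => f i x v) u by case: (hsmooth i).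
have dfv i u v : differentiable (f i u) v by case: (hsmooth i) => _ [].
have luu i u u' v : sqn (grad_u (f i) u v - grad_u (f i) u' v) <= L ^+ 2 * sqn (u - u').
  have [_ [_ [h _]]] := hsmooth i.
  exact: (l2lipschitz_sqn (g := fun u => grad_u (f i) u v) hL0 LuL (h v)).
have luv i u v v' : sqn (grad_u (f i) u v - grad_u (f i) u v') <= L ^+ 2 * sqn (v - v').
  have [_ [_ [_ [h _]]]] := hsmooth i.
  exact: (l2lipschitz_sqn (g := fun v => grad_u (f i) u v) hL0 LuvL (h u)).
have lvv i u v v' : sqn (grad_v (f i) u v - grad_v (f i) u v') <= L ^+ 2 * sqn (v - v').
  have [_ [_ [_ [_ [h _]]]]] := hsmooth i.
  exact: (l2lipschitz_sqn (g := fun v => grad_v (f i) u v) hL0 LvL (h u)).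
have lvu i u u' v : sqn (grad_v (f i) u v - grad_v (f i) u' v) <= L ^+ 2 * sqn (u - u').
  have [_ [_ [_ [_ [_ h]]]]] := hsmooth i.
  exact: (l2lipschitz_sqn (g := fun u => grad_v (f i) u v) hL0 LvuL (h v)).
have f_inf u v : n%:R^-1 * (\sum_(i < n) f i u0 (v0 i)) - F0
    <= n%:R^-1 * \sum_(i < n) f i u (v i).
  have : (ereal_inf [set (global_obj f p.1 p.2)%:E
      | p in [set: 'rV[R]_du * ('I_n -> 'rV[R]_dv)]] <= (global_obj f u v)%:E)%E.
    by apply: ereal_inf_lbound; exists (u, v).
  (* An infinite infimum would make the gap infinite, contradicting its equality with the real
     F0. *)
  move: hF0; rewrite /obj_gap -/f; case: ereal_inf => [r| |] //=.
  by move=> -[<-]; rewrite lee_fin /global_obj; lra.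
have small : gamma * L * K%:R <= 1 / 84.
  move: hgam; rewrite ler_pdivlMr ?mulr_gt0//; lra.
have hBn : n%:R^-1 * (\sum_(i < n) sqn (grad_u (f i) u0 (v0 i))) * T%:R
    <= L * F0 * eta_u ^+ 2.
  have := eta2 _ _ hB; rewrite ler_pdivrMr ?mulr_gt0// => h.
  rewrite -mulrA ler_pdivrMl// -/B0.
  have -> : \sum_(i < n) sqn (grad_u (f i) u0 (v0 i)) = B0.
    by apply: eq_bigr => i _; rewrite l2norm_sqr.
  apply: le_trans (h _) _.
    by apply: divr_ge0; [exact: mulr_ge0|rewrite ltW// !mulr_gt0].
  by rewrite le_eqVlt; apply/orP; left; apply/eqP; ring.
have bound := @expected_gradients_le R d dX Omega Xi P n du dv T K D F f xi u0 v0
  L sigma_u sigma_v gamma_u gamma_v eta_u eta_v hL0 hn mF dFu dFv hxi hgrad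
  luu luv lvu lvv gamma F0 hT hK dfu dfv hgu hgv heu hev hgamma_u hgamma_v small
  hF00 hT1 (eta2 _ (ler0n _ _) hn1) hev1 hBn f_inf.
pose GU := gradient_u K F f xi u0 v0 gamma_u gamma_v eta_u eta_v.
pose GV := gradient_v K F f xi u0 v0 gamma_u gamma_v eta_u eta_v.
have sG (t : 'I_T) : vsq_summable P (GU t) /\ forall i, vsq_summable P (GV t i).
  exact: (gradient_vsq_summable u0 v0 gamma_u gamma_v eta_u eta_v
    hL0 mF dFu dFv hxi hgrad luu luv lvu lvv (ltn_ord t)).
have avgE : avg = (T%:R^-1 * \sum_(t < T) (mean P (fun w => sqn (GU t w))
     + n%:R^-1 * \sum_(i < n) mean P (fun w => sqn (GV t i w))))%:E.
  rewrite /avg big_mkord EFinM -sumEFin; congr (_ * _)%E.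
  apply: eq_bigr => t _; have [sGU sGV] := sG t.
  rewrite EFinD EFinM -sumEFin; congr (_ + _)%E.
    rewrite -meanE; last exact: vsq_summable_sqn.
    rewrite /Gu; congr expectation; apply/funext => w.
    by rewrite l2norm_sqr grad_u_global_obj.
  rewrite /Gv; congr (_ * _)%E; apply: eq_bigr => i _.
  rewrite -meanE; last exact: vsq_summable_sqn.
  by congr expectation; apply/funext => w; rewrite l2norm_sqr.
have first_bound : (avg <= (4 * F0 / (T%:R * K%:R * gamma) + 44 * L * sigma2 * gamma
           + L * F0 / T%:R)%:E)%E.
  rewrite avgE lee_fin ler_pdivrMl// (le_trans bound)// le_eqVlt; apply/orP; left.
  by apply/eqP; rewrite -/sigma2; field; rewrite !gt_eqF.
split=> // ge; apply: (le_trans first_bound); rewrite lee_fin.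
exact: step_size_bound.
Qed.
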